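(* Let $\mathcal D=(V,E)$ be a directed acyclic graph on $V=\{1,\dots,p\}$ in a parent ordering, $U$ a symmetric positive definite $p\times p$ matrix, and $\alpha\in\mathbb R^p$ with $\alpha_i>pa_i+2$ for all $i$. Let $(D,L)\sim\pi^{\Theta_{\mathcal D}}_{U,\alpha}$, let $\Omega=LD^{-1}L^\top$, and let $\Upsilon=\Omega^E=\psi(D,L)$, whose law on $\mathrm R_{\mathcal D}$ is denoted $\pi^{\mathrm R_{\mathcal D}}_{U,\alpha}$. Then: (a) The density of $\Upsilon\sim\pi^{\mathrm R_{\mathcal D}}_{U,\alpha}$ with respect to the standard Lebesgue measure on $\mathrm R_{\mathcal D}$ is $$z_{\mathcal D}(U,\alpha)^{-1}\exp\Big\{-\tfrac12\operatorname{tr}(\widehat\Upsilon U)\Big\}\prod_{i=1}^pD_{ii}^{-\frac12\alpha_i+pa_i+2},$$ where $D_{ii}=(\widehat\Upsilon^{-1})_{ii\mid\prec i\succ}$ is a function of $\Upsilon$. (b) For every symmetric $p\times p$ matrix $K$ such that $U+2K$ is positive definite, $$E\{\exp[-\operatorname{tr}(K\Omega)]\}=\frac{z_{\mathcal D}(U+2K,\alpha)}{z_{\mathcal D}(U,\alpha)}.$$ Moreover, for $H\in\mathrm I_{\mathcal D}$ put $\langle H,\Upsilon\rangle_E=\sum_iH_{ii}\Upsilon_{ii}+\sum_{i>j,\,(i,j)\in E}H_{ij}\Upsilon_{ij}$, and let $K_H$ be the symmetric matrix with $(K_H)_{ii}=H_{ii}$, $(K_H)_{ij}=(K_H)_{ji}=H_{ij}/2$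 for $(i,j)\in E$, $i\ne j$, and zeros elsewhere. If $U+2K_H$ is positive definite, then $$E\{\exp[-\langle H,\Upsilon\rangle_E]\}=\frac{z_{\mathcal D}(U+2K_H,\alpha)}{z_{\mathcal D}(U,\alpha)}.$$ (c) The full precision-matrix mean is $$\mathbb E(\Omega)=\sum_{j=1}^p(\alpha_j-pa_j-2)\big(U_{\preceq j\succeq}^{-1}\big)^0-\sum_{j=1}^p(\alpha_j-pa_j-3)\big(U_{\prec j\succ}^{-1}\big)^0,$$ and consequently $\mathbb E(\Upsilon)=\mathbb E(\Omega)^E$.
   Context: Parent ordering: every directed edge $i\to j$ satisfies $i>j$. $E$ contains all loops $(i,i)$, and for $i\neq j$, $(i,j)\in E$ means $i\to j$. $\mathrm{pa}(i)$ is the set of parents of $i$ (excluding $i$), $pa_i=|\mathrm{pa}(i)|$, $\mathrm{fa}(i)=\mathrm{pa}(i)\cup\{i\}$. For a $p\times p$ matrix $A$: $A_{\prec i\succ}$ and $A_{\preceq i\succeq}$ are the principal submatrices indexed by $\mathrm{pa}(i)$ and $\mathrm{fa}(i)$; $A_{\prec i]}=(A_{ji})_{j\in\mathrm{pa}(i)}$ (column), $A_{[i\succ}=(A_{ij})_{j\in\mathrm{pa}(i)}$ (row); $A_{ii\mid\prec i\succ}=A_{ii}-A_{[i\succ}A_{\prec i\succ}^{-1}A_{\prec i]}$. $U_{\prec i\succ}^{-1}$ means $(U_{\prec i\succ})^{-1}$, and similarly for $\preceq i\succeq$. For an empty parent set, determinants equal one and the associated vectors, quadratic forms and matrices are absent.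 For a matrix $B$ indexed by a subset of $V$, $(B)^0$ is the $p\times p$ matrix obtained by padding with zeros. $\mathcal L_{\mathcal D}$: real lower triangular $p\times p$ matrices with unit diagonal and $L_{ij}=0$ for $i\neq j$, $i\notin\mathrm{pa}(j)$. $\Theta_{\mathcal D}$: pairs $(D,L)$ with $D$ diagonal with strictly positive diagonal and $L\in\mathcal L_{\mathcal D}$. The DAG--Wishart distribution $\pi^{\Theta_{\mathcal D}}_{U,\alpha}$ has density $z_{\mathcal D}(U,\alpha)^{-1}\exp\{-\frac12\operatorname{tr}(LD^{-1}L^\top U)\}\prod_iD_{ii}^{-\alpha_i/2}$ with respect to $\prod_idD_{ii}\prod_i\prod_{j\in\mathrm{pa}(i)}dL_{ji}$, where $$z_{\mathcal D}(U,\alpha)=\prod_{i=1}^p2^{\alpha_i/2-1}\pi^{pa_i/2}\Gamma(a_i)\det(U_{\prec i\succ})^{-1/2}U_{ii\mid\prec i\succ}^{-a_i},\qquad a_i=\tfrac{\alpha_i-pa_i}2-1.$$ $\mathrm P_{\mathcal D}=\{LD^{-1}L^\top:(D,L)\in\Theta_{\mathcal D}\}$ is the space of precision matrices. $\mathrm I_{\mathcal D}\cong\mathbb R^{|E|}$ is the space of $\mathcal D$-incomplete symmetric matrices $\Gamma=(\Gamma_{ij})$, with $\Gamma_{ij}=\Gamma_{ji}$ specified only on diagonal positions and positions of edges of the undirected version of $\mathcal D$ (one real coordinate per element of $E$). $A\mapsto A^E$ is the projection of symmetric matrices onto $\mathrm I_{\mathcal D}$ keeping those entries. $\mathrm R_{\mathcal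 D}=\{\Omega^E:\Omega\in\mathrm P_{\mathcal D}\}$, an open subset of $\mathrm I_{\mathcal D}$; for $\Upsilon\in\mathrm R_{\mathcal D}$, $\widehat\Upsilon$ is the unique element of $\mathrm P_{\mathcal D}$ with $\widehat\Upsilon^E=\Upsilon$. $\psi:\Theta_{\mathcal D}\to\mathrm R_{\mathcal D}$, $\psi(D,L)=(LD^{-1}L^\top)^E$. *)

(* Defs.v *)
From HB Require Import structures.
From mathcomp Require Import all_boot all_order all_algebra.
From mathcomp Require Import all_classical all_reals all_analysis.
Set Implicit Arguments.
Unset Strict Implicit.
Unset Printing Implicit Defensive.
Import Order.TTheory GRing.Theory Num.Theory.
Import numFieldNormedType.Exports.
Local Open Scope classical_set_scope.
Local Open Scope ring_scope.

(* R^n with its product (Borel) sigma-algebra and n-dimensional Lebesgue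
   measure, obtained by iterating the binary product measure;
   [lebesgue_Rn_box] checks its value on boxes. *)
Definition Rn (R : realType) (n : nat) := n.-tuple (measurableTypeR R).
HB.instance Definition _ (R : realType) n := Measurable.on (Rn R n).

Definition Rn_cons (R : realType) n (xt : measurableTypeR R * Rn R n) : Rn R n.+1 :=
  [tuple of xt.1 :: xt.2].

Lemma measurable_Rn_cons (R : realType) n : measurable_fun setT (@Rn_cons R n).
Proof. exact: measurable_cons. Qed.

Section cons_measure.
Context {R : realType} (n : nat) (mu : {sigma_finite_measure set (Rn R n) -> \bar R}).
Local Open Scope ereal_scope.

Definition cons_measure : set (Rn R n.+1) -> \bar R :=
  pushforward (lebesgue_measure \x mu) (@Rn_cons R n).

Let mcons A : measurable A -> measurable (@Rn_cons R n @^-1` A).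
Proof. by move=> mA; rewrite -[X in measurable X]setTI; exact: measurable_Rn_cons. Qed.

Let cons_measure0 : cons_measure set0 = 0.
Proof. by rewrite /cons_measure /pushforward preimage_set0 measure0. Qed.

Let cons_measure_ge0 A : 0 <= cons_measure A.
Proof. by rewrite /cons_measure /pushforward; exact: measure_ge0. Qed.

Let cons_measure_sigma_additive : semi_sigma_additive cons_measure.
Proof.
move=> F mF tF mUF; rewrite /cons_measure /pushforward preimage_bigcup.
apply: measure_semi_sigma_additive.
- by move=> k; exact: mcons.
- apply/trivIsetP => /= i j _ _ ij; rewrite -preimage_setI.
  by move/trivIsetP : tF => /(_ _ _ _ _ ij) ->//; rewrite preimage_set0.
- by rewrite -preimage_bigcup; exact: mcons.
Qed.

HB.instance Definition _ := isMeasure.Build _ _ _ cons_measure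
  cons_measure0 cons_measure_ge0 cons_measure_sigma_additive.

Let cons_measure_sigma_finite : sigma_finite setT cons_measure.
Proof.
have /sigma_finiteP[F [TF ndF Foo]] := sigma_finiteT (@lebesgue_measure R).
have /sigma_finiteP[G [TG ndG Goo]] := sigma_finiteT mu.
pose g (x : Rn R n.+1) : measurableTypeR R * Rn R n := (tnth x ord0, [tuple of behead x]).
have mg : measurable_fun setT g.
  apply/measurable_fun_pairP; split.
    exact: (@measurable_tnth _ (measurableTypeR R) n.+1 ord0).
  exact: measurable_behead.
have gK : cancel (@Rn_cons R n) g.
  by move=> [x t]; rewrite /g /Rn_cons /=; congr pair; apply/val_inj.
exists (fun k => g @^-1` (F k `*` G k)).
  rewrite -preimage_bigcup -[LHS](preimage_setT g); congr preimage.
  apply/esym; rewrite -subTset => -[x y] _.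
  have [i _ Fix] : (\bigcup_i F i) x by rewrite -TF.
  have [j _ Gjy] : (\bigcup_i G i) y by rewrite -TG.
  exists (maxn i j) => //; split => /=.
  - by move: x Fix; exact/subsetPset/ndF/leq_maxl.
  - by move: y Gjy; exact/subsetPset/ndG/leq_maxr.
move=> k; have [mF Fk] := Foo k; have [mG Gk] := Goo k; split.
  by rewrite -[X in measurable X]setTI; apply: mg => //; exact: measurableX.
rewrite [X in X < _](_ : _ = (lebesgue_measure \x mu) (F k `*` G k))//.
  by rewrite product_measure1E// lte_mul_pinfty// ge0_fin_numE.
rewrite /cons_measure /pushforward; congr (_ _).
by rewrite -comp_preimage (_ : g \o _ = id) ?preimage_id//; exact/funext.
Qed.

HB.instance Definition _ := Measure_isSigmaFinite.Build _ _ _ cons_measure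
  cons_measure_sigma_finite.

End cons_measure.

Fixpoint lebesgue_Rn (R : realType) n : {sigma_finite_measure set (Rn R n) -> \bar R} :=
  match n return {sigma_finite_measure set (Rn R n) -> \bar R} with
  | 0 => \d_([tuple] : Rn R 0)
  | n.+1 => cons_measure (lebesgue_Rn R n)
  end.

Lemma lebesgue_Rn_box (R : realType) n (A : 'I_n -> set (measurableTypeR R)) :
  (forall i, measurable (A i)) ->
  lebesgue_Rn R n [set x | forall i, A i (tnth x i)] =
  (\prod_(i < n) lebesgue_measure (A i))%E.
Proof.
elim: n A => [|n IH] A mA.
  rewrite big_ord0 /= diracE mem_set//; by case.
rewrite big_ord_recl -IH// -product_measure1E//.
  rewrite /= /cons_measure /pushforward; congr (_ _).
  apply/seteqP; split=> -[x t] /=.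
    move=> H; split; first exact: (H ord0).
    by move=> i; have := H (lift ord0 i); rewrite tnthS.
  by move=> [H0 H] i; case: (unliftP ord0 i) => [j|] ->; rewrite ?tnthS.
pose T := Rn R n.
rewrite (_ : [set x | _] = \bigcap_(i in [set: 'I_n]) ((fun x : T => tnth x i) @^-1` A (lift ord0 i))).
  apply: fin_bigcap_measurable => // i _.
  by rewrite -[X in measurable X]setTI; exact: (@measurable_tnth _ (measurableTypeR R) n i).
by apply/seteqP; split=> x /= H i; [move=> _|]; apply: H.
Qed.

(* Law of X : the measure on the Borel sets of R^n with density f with respect
   to the Lebesgue measure on S; in particular X belongs to S almost surely. *)
Definition has_density (R : realType) d (T : measurableType d)
    (P : probability T R) n (X : T -> Rn R n) (S : set (Rn R n))
    (f : Rn R n -> R) : Prop :=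
  [/\ measurable_fun setT X, measurable S,
      measurable_fun S (f : _ -> measurableTypeR R),
      (forall x, S x -> 0 <= f x) &
      forall A, measurable A ->
        P (X @^-1` A) = (\int[lebesgue_Rn R n]_(x in S `&` A) (f x)%:E)%E].

Definition Gamma (R : realType) (a : R) : R :=
  \int[lebesgue_measure]_(x in `]0, +oo[) (x `^ (a - 1) * expR (- x)).

Section matrices.
Context {R : realType} {p : nat}.
Implicit Types (A : 'M[R]_p) (S : {set 'I_p}) (i : 'I_p).

Definition posdefmx A : Prop :=
  A^T = A /\ forall v : 'cV[R]_p, v != 0 -> 0 < (v^T *m A *m v) 0 0.

(* Indexing by [enum_val] lists the elements of S in increasing order; when S
   is empty the matrices below are 0 x 0 or have a 0 dimension, so determinants
   are 1 and quadratic forms vanish. *)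
Definition psubmx A S : 'M[R]_#|S| :=
  \matrix_(k, l) A (enum_val k) (enum_val l).

Definition subcol A S i : 'cV[R]_#|S| := \col_k A (enum_val k) i.

Definition subrow A i S : 'rV[R]_#|S| := \row_k A i (enum_val k).

Definition condvar A i S : R :=
  A i i - (subrow A i S *m invmx (psubmx A S) *m subcol A S i) 0 0.

Definition padmx S (B : 'M[R]_#|S|) : 'M[R]_p :=
  \matrix_(i, j) \sum_(k | enum_val k == i) \sum_(l | enum_val l == j) B k l.

End matrices.

Section dag.
Context {R : realType} {p : nat}.
Variable E : {set 'I_p * 'I_p}.
Implicit Types (i j : 'I_p) (D L A Om : 'M[R]_p).

(* Acyclicity follows from the ordering condition. *)
Definition parent_dag : Prop :=
  (forall i, (i, i) \in E) /\
  (forall i j, (i, j) \in E -> i != j -> (j < i)%N).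

Definition pa i : {set 'I_p} := [set j | (j != i) && ((j, i) \in E)].

Definition fa i : {set 'I_p} := i |: pa i.

Definition LD : set 'M[R]_p :=
  [set L | [/\ is_trig_mx L, forall i, L i i = 1 &
    forall i j, i != j -> i \notin pa j -> L i j = 0]].

Definition Theta : set ('M[R]_p * 'M[R]_p) :=
  [set DL | [/\ is_diag_mx DL.1, forall i, 0 < DL.1 i i & LD DL.2]].

Definition precision D L : 'M[R]_p := L *m invmx D *m L^T.

Definition PD : set 'M[R]_p :=
  [set Om | exists2 DL, Theta DL & Om = precision DL.1 DL.2].

(* R^|E| with one coordinate per element of E: both the space of incomplete
   matrices and the chart of [Theta] used to define its reference measure. *)
Definition RE := Rn R #|E|.

(* The coordinate of position e, and 0 when e is not in E. *)
Definition entry (x : RE) (e : 'I_p * 'I_p) : R :=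
  \sum_(k | enum_val k == e) tnth x k.

Definition projRE A : RE :=
  [tuple A (enum_val k).1 (enum_val k).2 | k < #|E|].

Definition RD : set RE := projRE @` PD.

(* The element of [PD] projecting on Y, for Y in [RD]. *)
Definition completion (Y : RE) : 'M[R]_p :=
  xget 0 [set Om | PD Om /\ projRE Om = Y].

Definition psi D L : RE := projRE (precision D L).

Definition a_of (alpha : 'I_p -> R) i : R := (alpha i - #|pa i|%:R) / 2 - 1.

Definition zD (U : 'M[R]_p) (alpha : 'I_p -> R) : R :=
  \prod_i (2 `^ (alpha i / 2 - 1) * pi `^ (#|pa i|%:R / 2) *
    Gamma (a_of alpha i) * \det (psubmx U (pa i)) `^ (- (1 / 2)) *
    condvar U i (pa i) `^ (- a_of alpha i)).

Definition theta_density U alpha D L : R :=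
  (zD U alpha)^-1 * expR (- (1 / 2) * \tr (precision D L *m U)) *
  \prod_i D i i `^ (- (alpha i / 2)).

(* Chart of [Theta]: D_ii at position (i, i), L_ji at position (j, i) for
   j a parent of i. *)
Definition theta_coord D L : RE :=
  [tuple let e := enum_val k in if e.1 == e.2 then D e.1 e.1 else L e.1 e.2
  | k < #|E|].

Definition coordD (x : RE) : 'M[R]_p :=
  \matrix_(i, j) (entry x (i, i) *+ (i == j)).

Definition coordL (x : RE) : 'M[R]_p :=
  \matrix_(i, j) (if i == j then 1 else entry x (i, j)).

Definition DAG_Wishart U alpha d (T : measurableType d) (P : probability T R)
    (D L : T -> 'M[R]_p) : Prop :=
  (forall t, Theta (D t, L t)) /\
  has_density P (fun t => theta_coord (D t) (L t))
    [set x | Theta (coordD x, coordL x)]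
    (fun x => theta_density U alpha (coordD x) (coordL x)).

Definition RD_density U alpha (Y : RE) : R :=
  (zD U alpha)^-1 * expR (- (1 / 2) * \tr (completion Y *m U)) *
  \prod_i condvar (invmx (completion Y)) i (pa i)
    `^ (- (1 / 2) * alpha i + #|pa i|%:R + 2).

Definition pairing (H Y : RE) : R :=
  \sum_i entry H (i, i) * entry Y (i, i) +
  \sum_(e in E | (e.2 < e.1)%N) entry H e * entry Y e.

Definition KH (H : RE) : 'M[R]_p :=
  \matrix_(i, j) (if i == j then entry H (i, i)
    else if (i, j) \in E then entry H (i, j) / 2
    else if (j, i) \in E then entry H (j, i) / 2
    else 0).

Definition mean_precision (U : 'M[R]_p) (alpha : 'I_p -> R) : 'M[R]_p :=
  \sum_j (alpha j - #|pa j|%:R - 2) *: padmx (invmx (psubmx U (fa j))) -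
  \sum_j (alpha j - #|pa j|%:R - 3) *: padmx (invmx (psubmx U (pa j))).

End dag.

Arguments RD {R p} E _ : assert.
Arguments completion {R p} E Y : assert.
Arguments RD_density {R p} E U alpha Y : assert.

Section expectations.
Context {R : realType} d (T : measurableType d) (P : probability T R).

Definition expect_mx p (X : T -> 'M[R]_p) : 'M[R]_p :=
  \matrix_(i, j) fine 'E_P[fun t => X t i j].

Definition expect_Rn n (X : T -> Rn R n) : Rn R n :=
  [tuple fine 'E_P[fun t => tnth (X t) k] | k < n].

End expectations.

(* Main.v *)
From HB Require Import structures.
Require Import Defs.
From mathcomp Require Import all_boot all_order all_algebra.
From mathcomp Require Import all_classical all_reals all_analysis.
From mathcomp Require Import measurable_realfun measurable_fun_approximation.
From mathcomp Require Import ring lra.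

(** Write [L_j] for the j-th column of [L].  The trace splits over columns,
    [tr (L D^-1 L^T U) = sum_j D_jj^-1 L_j^T U L_j], and [L_j] is the j-th unit
    vector plus free coordinates on [pa j].  Completing the square,
    [L_j^T U L_j] is [condvar U j (pa j)] plus a form with matrix
    [psubmx U (pa j)] in the recentred free coordinates
    ([quadratic_complete]).  Integrating out the free coordinates (Gaussian)
    and then [D_jj] (inverse gamma) shows that the unnormalised density has
    total mass [zD U alpha] as soon as the gamma integrals converge
    ([theta_kernel_integral]).  The rest follows from this identity.

    Laplace transform.  Multiplying the kernel at [U] by [exp (- tr (K Omega))]
    gives the kernel at [U + 2 K], so the expectation is a ratio of two
    normalising constants ([laplace_transform]); the pairing of incomplete
    matrices is [tr (K_H Omega)] ([pairing_trace]).

    Mean.  Put [Y = v^T Omega v / 2].  The Laplace transform at a rank one [K]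
    gives [E (exp (- s Y))] for [s >= 0], and the rank one update formulas for
    determinants and Schur complements make it explicit in [s]
    ([zD_rank1]).  Since [n (1 - exp (- Y / n))] tends to [Y] and stays below
    it, Fatou's lemma on one side and monotonicity of the integral on the other
    identify [E Y] with minus the derivative of that function at 0
    ([expectation_half_quad]).
    Polarisation gives the entries of [E Omega].  The stated matrix appears
    because the derivative is a combination of the quadratic forms of the padded
    inverses over [fa j] and [pa j].

    Density of the incomplete matrix.  In the coordinates [tau_j = 1 / D_jj],
    [m_ij = L_ij / D_jj], written [y], the entry of [Omega] at [(i, j)] is
    [y_ij + sum_(k < j) y_ik y_jk / y_kk] ([psi_invert_chart]).  This is Gaussian
    elimination run backwards: a shear whose corrections involve earlier columns
    only, hence a bijection of the whole space with Jacobian one, and [RD] is the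
    image of the cone [tau > 0].  The passage from [(D, L)] to [y] contributes
    the factor [D_jj ^ (pa_j + 2)] for each [j], and [D_jj] is recovered as a
    conditional variance of the inverse precision ([condvar_inv_precision]).

    All three changes of variables are instances of
    [triangular_change_of_variables], obtained by substituting one coordinate at
    a time: two functions on R^n have the same integral as soon as their
    integrals along one coordinate agree ([integral_Rn_slice]). *)

Set Implicit Arguments.
Unset Strict Implicit.
Unset Printing Implicit Defensive.
Import Order.TTheory GRing.Theory Num.Theory.
Import numFieldNormedType.Exports.
Local Open Scope classical_set_scope.
Local Open Scope ring_scope.

(** * Integration on R^n along one coordinate *)

Section coordinates.
Context {R : realType}.
Implicit Types (n : nat).

Definition upd n (x : Rn R n) (k : 'I_n) (t : measurableTypeR R) : Rn R n :=
  [tuple if i == k then t else tnth x i | i < n].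

Lemma tnth_upd n (x : Rn R n) k t i :
  tnth (upd x k t) i = if i == k then t else tnth x i.
Proof. by rewrite tnth_mktuple. Qed.

Lemma upd_id n (x : Rn R n) k : upd x k (tnth x k) = x.
Proof. by apply: eq_from_tnth => i; rewrite tnth_upd; case: eqP => [->|]. Qed.

Lemma upd_upd n (x : Rn R n) k s t : upd (upd x k s) k t = upd x k t.
Proof. by apply: eq_from_tnth => i; rewrite !tnth_upd; case: eqP. Qed.

Lemma upd_cons0 n (t s : measurableTypeR R) (x : Rn R n) :
  upd (Rn_cons (t, x)) ord0 s = Rn_cons (s, x).
Proof.
apply: eq_from_tnth => i; rewrite tnth_upd.
by case: (unliftP ord0 i) => [j|] -> //=; rewrite !tnthS.
Qed.

Lemma upd_consS n (t s : measurableTypeR R) (x : Rn R n) k :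
  upd (Rn_cons (t, x)) (lift ord0 k) s = Rn_cons (t, upd x k s).
Proof.
apply: eq_from_tnth => i; rewrite tnth_upd.
case: (unliftP ord0 i) => [j|] -> //=; rewrite !tnthS tnth_upd.
by rewrite (inj_eq (@lift_inj _ _)).
Qed.

Lemma measurable_coord n (k : 'I_n) :
  measurable_fun setT (fun x : Rn R n => tnth x k : measurableTypeR R).
Proof. exact: (@measurable_tnth _ (measurableTypeR R) n k). Qed.

Lemma measurable_to_Rn d (T : measurableType d) n (f : T -> Rn R n) :
  (forall k, measurable_fun setT (fun t => tnth (f t) k : measurableTypeR R)) ->
  measurable_fun setT f.
Proof. by move=> h; apply/measurable_fun_tnthP. Qed.

Lemma measurable_upd d (T : measurableType d) n (k : 'I_n)
    (f : T -> Rn R n) (g : T -> measurableTypeR R) :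
  measurable_fun setT f -> measurable_fun setT g ->
  measurable_fun setT (fun z => upd (f z) k (g z)).
Proof.
move=> mf mg; apply: measurable_to_Rn => i.
under eq_fun do rewrite tnth_upd.
case: eqP => // _.
exact: (measurableT_comp (measurable_coord i) mf).
Qed.

Local Open Scope ereal_scope.

Lemma integral_lebesgue_RnS n (F : Rn R n.+1 -> \bar R) :
  measurable_fun setT F -> (forall x, 0 <= F x) ->
  \int[lebesgue_Rn R n.+1]_x F x =
  \int[lebesgue_measure \x lebesgue_Rn R n]_z F (Rn_cons z).
Proof.
move=> mF F0.
rewrite /= (ge0_integral_pushforward (@measurable_Rn_cons R n))//=.
Qed.

(** The dimension is peeled off one coordinate at a time by Tonelli: if [k] is
    the first coordinate the slice integral is the inner one, otherwise the first
    coordinate is the outer one and the induction hypothesis applies to it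
    frozen.  Statements that use this lemma are therefore insensitive to the
    order in which [lebesgue_Rn] enumerates the coordinates. *)
Lemma integral_Rn_slice n (k : 'I_n) (F G : Rn R n -> \bar R) :
  measurable_fun setT F -> measurable_fun setT G ->
  (forall x, 0 <= F x) -> (forall x, 0 <= G x) ->
  (forall x, \int[lebesgue_measure]_t F (upd x k t) =
             \int[lebesgue_measure]_t G (upd x k t)) ->
  \int[lebesgue_Rn R n]_x F x = \int[lebesgue_Rn R n]_x G x.
Proof.
elim: n => [|n IH] in k F G *; first by case: k.
move=> mF mG F0 G0 FG.
have mc (H : Rn R n.+1 -> \bar R) : measurable_fun setT H ->
    measurable_fun setT (fun z => H (@Rn_cons R n z)).
  by move=> mH; exact: (measurableT_comp mH (@measurable_Rn_cons R n)).
rewrite !integral_lebesgue_RnS//.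
case: (unliftP ord0 k) => [k'|] kE.
- rewrite !(fubini_tonelli1 (m1 := lebesgue_measure) (m2 := lebesgue_Rn R n))//; last 2 first.
    exact: mc.
    exact: mc.
  apply: eq_integral => t _; rewrite /fubini_F.
  apply: (IH k') => //.
  + exact: (measurableT_comp (mc _ mF) (pair1_measurable t)).
  + exact: (measurableT_comp (mc _ mG) (pair1_measurable t)).
  + move=> x; transitivity (\int[lebesgue_measure]_s F (upd (Rn_cons (t, x)) k s)).
      by apply: eq_integral => s _; rewrite kE upd_consS.
    by rewrite FG; apply: eq_integral => s _; rewrite kE upd_consS.
- rewrite !(fubini_tonelli2 (m1 := lebesgue_measure) (m2 := lebesgue_Rn R n))//; last 2 first.
    exact: mc.
    exact: mc.
  apply: eq_integral => x _; rewrite /fubini_G.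
  (* 0 is a dummy first coordinate, overwritten by the update *)
  transitivity (\int[lebesgue_measure]_s F (upd (Rn_cons (0%R, x)) k s)).
    by apply: eq_integral => s _; rewrite kE upd_cons0.
  by rewrite FG; apply: eq_integral => s _; rewrite kE upd_cons0.
Qed.

Lemma integral_Rn_prod n (g : 'I_n -> measurableTypeR R -> R) :
  (forall k, measurable_fun setT (g k)) -> (forall k t, 0 <= g k t)%R ->
  \int[lebesgue_Rn R n]_x (\prod_k g k (tnth x k))%:E =
  \prod_k \int[lebesgue_measure]_t (g k t)%:E.
Proof.
have mprod m (h : 'I_m -> measurableTypeR R -> R) :
    (forall k, measurable_fun setT (h k)) ->
    measurable_fun setT (fun x : Rn R m => (\prod_k h k (tnth x k))%:E).
  move=> mh; apply/measurable_EFinP; apply: measurable_prod => k _.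
  exact: (measurableT_comp (mh k) (measurable_coord k)).
elim: n => [|n IH] in g *; move=> mg g0.
  rewrite big_ord0 /= integral_dirac//=; last exact: mprod.
  by rewrite diracT mul1e big_ord0.
rewrite integral_lebesgue_RnS; [|exact: mprod|]; last first.
  by move=> x; rewrite lee_fin prodr_ge0.
rewrite (fubini_tonelli1 (m1 := lebesgue_measure) (m2 := lebesgue_Rn R n))//=; last 2 first.
- exact: (measurableT_comp (mprod _ _ mg) (@measurable_Rn_cons R n)).
- by move=> z; rewrite lee_fin prodr_ge0.
rewrite /fubini_F big_ord_recl -IH//.
rewrite -ge0_integralZr//=; last 3 first.
- exact/measurable_EFinP.
- by move=> t _; rewrite lee_fin.
- by apply: integral_ge0 => x _; rewrite lee_fin prodr_ge0.
apply: eq_integral => t _.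
rewrite -ge0_integralZl//=; last 3 first.
- exact: (mprod _ (fun i => g (lift ord0 i))).
- by move=> x _; rewrite lee_fin prodr_ge0.
- by rewrite lee_fin.
apply: eq_integral => x _.
rewrite big_ord_recl EFinM; congr (_ * (_)%:E).
by apply: eq_bigr => i _; rewrite tnthS.
Qed.

End coordinates.

(** * Triangular changes of variables *)

Section triangular.
Context {R : realType} (n : nat).
Variable r : 'I_n -> nat.

(** [r] ranks the coordinates; a map is triangular when its k-th component reads
    only the k-th coordinate and coordinates of smaller rank.  Coordinates of
    equal rank do not see each other. *)
Definition depends_upto (k : 'I_n) (v : Rn R n -> R) :=
  forall x y : Rn R n,
    (forall i, (i == k) || (r i < r k)%N -> tnth x i = tnth y i) -> v x = v y.

Definition depends_below (k : 'I_n) (v : Rn R n -> R) :=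
  forall x y : Rn R n, (forall i, (r i < r k)%N -> tnth x i = tnth y i) -> v x = v y.

Lemma depends_belowW k v : depends_below k v -> depends_upto k v.
Proof. by move=> vk x y xy; apply: vk => i ri; apply: xy; rewrite ri orbT. Qed.

(** The state reached when only the coordinates in [s] have been replaced; it
    interpolates between the identity and the full map. *)
Definition partial_map (u : 'I_n -> Rn R n -> R) (s : seq 'I_n) (x : Rn R n) : Rn R n :=
  [tuple if i \in s then u i x else tnth x i | i < n].

Let le_rank := fun i j : 'I_n => (r i <= r j)%N.

(** Coordinates are processed by decreasing rank, so that those already replaced
    are invisible to the component substituted next.  Hence replacing all
    coordinates simultaneously is the same as replacing them in turn. *)
Lemma partial_map_cons u k s x : depends_upto k (u k) ->
  uniq (k :: s) -> sorted le_rank (k :: s) ->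
  partial_map u (k :: s) x =
    upd (partial_map u s x) k (u k (partial_map u s x)) /\
  forall v, depends_upto k v -> v (partial_map u s x) = v x.
Proof.
move=> uk /= /andP[ks _] pks.
have le_trans : transitive le_rank by move=> j i l; exact: leq_trans.
have sk := allP (order_path_min le_trans pks).
have vE v : depends_upto k v -> v (partial_map u s x) = v x.
  move=> vk; apply: vk => i /orP[/eqP ->|rik]; rewrite tnth_mktuple.
    by rewrite (negbTE ks).
  by case: ifPn => // /sk; rewrite /le_rank leqNgt rik.
split => //; apply: eq_from_tnth => i; rewrite tnth_upd !tnth_mktuple in_cons.
by case: eqP => [->|//]; rewrite vE.
Qed.

Lemma sorted_enum_rank : exists s : seq 'I_n,
  [/\ uniq s, sorted le_rank s & forall i, i \in s].
Proof.
exists (sort le_rank (enum 'I_n)); split.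
- by rewrite sort_uniq enum_uniq.
- by apply: sort_sorted => i j; exact: leq_total.
- by move=> i; rewrite mem_sort mem_enum.
Qed.

(** The change of variables formula reduces to a one-dimensional identity in each
    coordinate, with the others frozen.  The weight [rho k] plays the role of a
    Jacobian in the old variables, and [sigma k] restricts the domain of the new
    ones; allowing an indicator in both covers substitutions, such as the
    inversion of a positive coordinate, that are only defined on part of the
    line. *)
Lemma triangular_change_of_variables
    (u rho : 'I_n -> Rn R n -> R) (sigma : 'I_n -> measurableTypeR R -> R) :
  (forall k, depends_upto k (u k)) -> (forall k, depends_upto k (rho k)) ->
  (forall k, measurable_fun setT (u k)) ->
  (forall k, measurable_fun setT (rho k)) ->
  (forall k, measurable_fun setT (sigma k)) ->
  (forall k x, 0 <= rho k x) -> (forall k t, 0 <= sigma k t) ->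
  (forall k x (f : measurableTypeR R -> R), measurable_fun setT f ->
    (forall t, 0 <= f t) ->
    (\int[lebesgue_measure]_t (f (u k (upd x k t)) * rho k (upd x k t))%:E =
     \int[lebesgue_measure]_t (f t * sigma k t)%:E)%E) ->
  forall F : Rn R n -> R, measurable_fun setT F -> (forall x, 0 <= F x) ->
  (\int[lebesgue_Rn R n]_x (F [tuple u k x | k < n] * \prod_k rho k x)%:E =
   \int[lebesgue_Rn R n]_x (F x * \prod_k sigma k (tnth x k))%:E)%E.
Proof.
move=> uk rk mu mr ms r0 s0 H.
have aux s : uniq s -> sorted le_rank s ->
    forall F : Rn R n -> R, measurable_fun setT F -> (forall x, 0 <= F x) ->
    (\int[lebesgue_Rn R n]_x
       (F (partial_map u s x) * \prod_(k <- s) rho k x)%:E =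
     \int[lebesgue_Rn R n]_x
       (F x * \prod_(k <- s) sigma k (tnth x k))%:E)%E.
  elim: s => [_ _ F mF F0|k s IH us ss F mF F0].
    apply: eq_integral => x _; rewrite !big_nil; congr (F _ * _)%:E.
    by apply: eq_from_tnth => i; rewrite tnth_mktuple.
  (* Both the substitution and the weight at k can be evaluated after the
     coordinates in s have been replaced: G absorbs them. *)
  pose G y := F (upd y k (u k y)) * rho k y.
  have mG : measurable_fun setT G.
    apply: measurable_funM => //; apply: (measurableT_comp mF).
    by apply: (@measurable_upd _ _ _ n k id); [exact: measurable_id|exact: mu].
  have G0 y : 0 <= G y by rewrite mulr_ge0.
  have msig l : measurable_fun setT
      (fun x : Rn R n => \prod_(j <- l) sigma j (tnth x j)).
    apply: measurable_prod => j _.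
    exact: (measurableT_comp (ms j) (measurable_coord j)).
  transitivity (\int[lebesgue_Rn R n]_x
      (G (partial_map u s x) * \prod_(j <- s) rho j x)%:E)%E.
    apply: eq_integral => x _; rewrite /G big_cons.
    have [-> vE] := partial_map_cons x (uk k) us ss.
    by rewrite (vE (rho k))// mulrA.
  have [/= /andP[ks us'] ss'] := (us, path_sorted ss).
  rewrite (IH us' ss' G mG G0).
  apply: (integral_Rn_slice (k := k)) => [| | | |x].
  - by apply/measurable_EFinP; apply: measurable_funM mG (msig _).
  - by apply/measurable_EFinP; apply: measurable_funM mF (msig _).
  - by move=> x; rewrite lee_fin mulr_ge0// prodr_ge0.
  - by move=> x; rewrite lee_fin mulr_ge0// prodr_ge0.
  have cE t : \prod_(j <- s) sigma j (tnth (upd x k t) j) =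
      \prod_(j <- s) sigma j (tnth x j).
    rewrite !big_seq; apply: eq_bigr => j js; rewrite tnth_upd.
    by case: eqP ks => // <-; rewrite js.
  set c := \prod_(j <- s) sigma j (tnth x j) in cE.
  have c0 : 0 <= c by rewrite prodr_ge0.
  pose f t := F (upd x k t) * c.
  have mf : measurable_fun setT f.
    apply: measurable_funM => //; apply: (measurableT_comp mF).
    by apply: (@measurable_upd _ _ _ n k (cst x) id); [exact: measurable_cst|exact: measurable_id].
  transitivity (\int[lebesgue_measure]_t
      (f (u k (upd x k t)) * rho k (upd x k t))%:E)%E.
    by apply: eq_integral => t _; rewrite /G cE upd_upd /f mulrAC.
  rewrite H//; last by move=> t; rewrite mulr_ge0.
  apply: eq_integral => t _; rewrite big_cons cE tnth_upd eqxx /f.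
  by rewrite mulrAC mulrA.
move=> F mF F0; have [s [us ss sT]] := sorted_enum_rank.
have prodE (h : 'I_n -> R) : \prod_k h k = \prod_(k <- s) h k.
  apply: perm_big; apply: uniq_perm => //; first exact: index_enum_uniq.
  by move=> i; rewrite sT mem_index_enum.
have := aux s us ss F mF F0.
under [X in _ = X -> _]eq_integral do rewrite -prodE.
move=> <-; apply: eq_integral => x _; rewrite prodE; congr (F _ * _)%:E.
by apply: eq_from_tnth => i; rewrite !tnth_mktuple sT.
Qed.

(** A shear is undone coordinate by coordinate in the reverse order: the
    correction to the k-th coordinate is computed from coordinates that are
    already back to their original values. *)
Lemma shear_measurable_inverse (b : 'I_n -> Rn R n -> R) :
  (forall k, depends_below k (b k)) -> (forall k, measurable_fun setT (b k)) ->
  exists g : Rn R n -> Rn R n, [/\ measurable_fun setT g,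
    cancel (fun x : Rn R n => [tuple tnth x k + b k x | k < n] : Rn R n) g &
    cancel g (fun x : Rn R n => [tuple tnth x k + b k x | k < n] : Rn R n)].
Proof.
move=> bk mb; pose u k (x : Rn R n) := tnth x k + b k x.
have uk k : depends_upto k (u k).
  move=> x y xy; rewrite /u (depends_belowW (bk k) xy) xy//.
  by rewrite eqxx.
have aux s : uniq s -> sorted le_rank s ->
    exists g : Rn R n -> Rn R n, [/\ measurable_fun setT g,
      cancel (partial_map u s) g & cancel g (partial_map u s)].
  elim: s => [_ _|k s IH us ss].
    have E x : partial_map u [::] x = x.
      by apply: eq_from_tnth => i; rewrite tnth_mktuple.
    by exists id; split => //.
  have /= /andP[ks us'] := us.
  have [g [mg gK Kg]] := IH us' (path_sorted ss).
  pose d (y : Rn R n) := upd y k (tnth y k - b k y).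
  have bupd y t : b k (upd y k t) = b k y.
    apply: bk => i; rewrite tnth_upd; case: eqP => // ->.
    by rewrite ltnn.
  exists (fun y => g (d y)); split.
  - apply: (measurableT_comp mg); apply: measurable_upd => //.
    by apply: measurable_funB => //; exact: measurable_coord.
  - move=> x; have [-> _] := partial_map_cons x (uk k) us ss.
    rewrite /d tnth_upd eqxx upd_upd bupd {1}/u.
    by rewrite addrK upd_id gK.
  - move=> y; have [-> _] := partial_map_cons (g (d y)) (uk k) us ss.
    rewrite Kg /d upd_upd /u tnth_upd eqxx bupd subrK.
    exact: upd_id.
have [s [us ss sT]] := sorted_enum_rank.
have [g [mg gK Kg]] := aux s us ss.
have E x : partial_map u s x = [tuple tnth x k + b k x | k < n].
  by apply: eq_from_tnth => i; rewrite !tnth_mktuple sT.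
by exists g; split => // x; rewrite -E.
Qed.

End triangular.

(** * Transport of integrals along a law with a density *)

Section transfer.
Context d1 d2 (T1 : measurableType d1) (T2 : measurableType d2) (R : realType).
Variables (m1 : {measure set T1 -> \bar R}) (m2 : {measure set T2 -> \bar R}).
Variables (D : set T1) (mD : measurable D).
Variables (X : T1 -> T2) (mX : measurable_fun setT X).
Variables (f : T2 -> R) (mf : measurable_fun setT f) (f0 : forall y, 0 <= f y).
Hypothesis law : forall A, measurable A ->
  m1 (D `&` X @^-1` A) = (\int[m2]_(y in A) (f y)%:E)%E.

Import HBNNSimple.

Local Open Scope ereal_scope.

Let mpre A : measurable A -> measurable (X @^-1` A).
Proof. by move=> mA; rewrite -[X in measurable X]setTI; exact: mX. Qed.

Let transfer_nnsfun (h : {nnsfun T2 >-> R}) :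
  \int[m1]_(x in D) (h (X x))%:E = \int[m2]_y (h y * f y)%:E.
Proof.
have mh r : measurable (h @^-1` [set r]) by exact: measurable_sfunP.
(* For a simple function both sides are the same combination of the masses of
   its level sets, to which the hypothesis applies. *)
transitivity (\sum_(k \in range h)
    \int[m1]_(x in D) (k * \1_(X @^-1` (h @^-1` [set k])) x)%:E).
  under eq_integral do rewrite fimfunE -fsumEFin//.
  rewrite ge0_integral_fsum//.
  - move=> r; apply/measurable_EFinP/measurable_funM => //.
    by apply: measurable_indic; exact: mpre.
  - by move=> r x _; rewrite -[X in 0 <= X]/((r * \1_(h @^-1` [set r]) (X x))%:E) nnfun_muleindic_ge0.
transitivity (\sum_(k \in range h)
    \int[m2]_y ((k * \1_(h @^-1` [set k]) y) * f y)%:E); last first.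
  rewrite -ge0_integral_fsum//.
  - apply: eq_integral => y _.
    rewrite [in RHS]fimfunE mulr_fsuml// fsumEFin//.
  - move=> r; apply/measurable_EFinP/measurable_funM => //.
    by apply: measurable_funM.
  - by move=> r y _; rewrite EFinM mule_ge0 ?lee_fin//; have := nnfun_muleindic_ge0 h r y; rewrite lee_fin.
apply: eq_fsbigr => r /set_mem[y _ <-].
rewrite (_ : (fun x => _) = (fun x => (h y)%:E * (\1_(X @^-1` (h @^-1` [set h y])) x)%:E)); last by apply/funext => x; rewrite EFinM.
rewrite ge0_integralZl//; last 2 first.
- by apply/measurable_EFinP/measurable_indic; exact: mpre.
- by rewrite lee_fin.
rewrite integral_indic//; last exact: mpre.
rewrite setIC law//.
transitivity (\int[m2]_y0
    ((h y)%:E * ((\1_(h @^-1` [set h y]) y0) * f y0)%:E)); last first.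
  by apply: eq_integral => z _; rewrite -EFinM mulrA.
rewrite ge0_integralZl//; last 3 first.
- by apply/measurable_EFinP/measurable_funM => //; apply: measurable_indic.
- by move=> x _; rewrite lee_fin mulr_ge0.
- by rewrite lee_fin.
congr (_ * _); rewrite integral_mkcond; apply: eq_integral => x _.
by rewrite patchE indicE; case: ifP; rewrite ?mul1r ?mul0r.
Qed.

(** The hypothesis says that the image of [m1] restricted to [D] has density [f]
    with respect to [m2].  It is used with [m1] a probability and [X] a random
    vector, and with [m1] the Lebesgue measure and [X] a substitution. *)
Lemma ge0_integral_transfer (g : T2 -> R) :
  measurable_fun setT g -> (forall y, 0 <= g y)%R ->
  \int[m1]_(x in D) (g (X x))%:E = \int[m2]_y (g y * f y)%:E.
Proof.
move=> mg g0.
have mg' : measurable_fun setT (EFin \o g) by exact/measurable_EFinP.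
have g0' y : [set: T2] y -> 0 <= (EFin \o g) y by rewrite lee_fin.
pose h := nnsfun_approx measurableT mg'.
have hg y : (h n y)%:E @[n --> \oo] --> (g y)%:E.
  exact: (cvg_nnsfun_approx measurableT mg' g0').
have hnd y a b : (a <= b)%N -> (h a y <= h b y)%R.
  by move=> ab; exact/lefP/nd_nnsfun_approx.
transitivity (limn (fun n => \int[m1]_(x in D) (h n (X x))%:E)).
  rewrite -monotone_convergence//.
  - by apply: eq_integral => x _; apply/esym/cvg_lim => //; exact: hg.
  - move=> n; apply/measurable_EFinP/(measurableT_comp _ (measurable_funTS mX)).
    exact: measurable_funP.
  - by move=> n x _; rewrite lee_fin.
  - by move=> x _ a b ab; rewrite lee_fin hnd.
under eq_fun do rewrite transfer_nnsfun.
rewrite -monotone_convergence//.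
- apply: eq_integral => y _; apply/cvg_lim => //.
  under eq_fun do rewrite EFinM; rewrite EFinM.
  by apply: cvgeZr => //; exact: hg.
- by move=> n; apply/measurable_EFinP/measurable_funM.
- by move=> n y _; rewrite lee_fin mulr_ge0.
- by move=> y _ a b ab; rewrite lee_fin ler_wpM2r// hnd.
Qed.

End transfer.

(** * Affine maps and inversion on the line *)

Local Notation image_measure :=
  measure_function_pushforward__canonical__measure_function_Measure.

Section affine_substitution.
Context {R : realType}.
Local Open Scope ereal_scope.

Lemma ge0_integral_affine (a b : R) (f : measurableTypeR R -> R) : (0 < a)%R ->
  measurable_fun setT f -> (forall t, 0 <= f t)%R ->
  \int[lebesgue_measure]_t (f (a * t + b) * a)%:E =
  \int[lebesgue_measure]_t (f t)%:E.
Proof.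
move=> a0 mf f0.
pose X (t : measurableTypeR R) : measurableTypeR R := (a * t + b)%R.
have mX : measurable_fun setT X.
  by apply: measurable_funD => //; apply: measurable_funM.
have leb A : measurable A ->
    lebesgue_measure A = a%:E * lebesgue_measure (X @^-1` A).
  move=> mA.
  pose m := mscale (NngNum (ltW a0)) (image_measure (@lebesgue_measure R) mX).
  (* The scaled image measure agrees with the Lebesgue measure on intervals. *)
  rewrite (lebesgue_measure_unique (mu := m))//= => _ [[u v]] _ <-.
  rewrite /m/= /mscale/= /pushforward.
  rewrite (_ : X @^-1` _ = `](u - b) / a, (v - b) / a]%classic)%R.
    rewrite !lebesgue_measure_itv/= !lte_fin ltr_pM2r ?invr_gt0// ltrD2r.
    case: ifPn => _; rewrite ?mule0// -EFinB -EFinM; congr EFin.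
    by field; rewrite gt_eqF.
  apply/seteqP; split => t; rewrite /X/= !in_itv/= => /andP[].
    rewrite -ltrBlDr -lerBrDr => ut tv.
    by rewrite ltr_pdivrMr// ler_pdivlMr// ![(t * a)%R]mulrC ut tv.
  rewrite ltr_pdivrMr// ler_pdivlMr// ![(t * a)%R]mulrC => ut tv.
  by rewrite -ltrBlDr -lerBrDr ut tv.
have law A : measurable A ->
    lebesgue_measure (setT `&` X @^-1` A) =
    \int[lebesgue_measure]_(y in A) (a^-1)%:E.
  move=> mA; rewrite setTI integral_cst// [X in _ = _ * X]leb//.
  by rewrite muleA -EFinM mulVf ?gt_eqF// mul1e.
transitivity (\int[lebesgue_measure]_t (f t * a * a^-1)%:E).
  have ma : measurable_fun setT (cst (a^-1)%R : measurableTypeR R -> R).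
    exact: measurable_cst.
  have a0' (t : measurableTypeR R) : (0 <= cst (a^-1) t :> R)%R by rewrite invr_ge0 ltW.
  pose g (t : measurableTypeR R) := (f t * a)%R.
  have mg : measurable_fun setT g by exact: measurable_funM.
  have g0 t : (0 <= g t)%R by rewrite mulr_ge0// ltW.
  exact: (ge0_integral_transfer measurableT mX ma a0' law mg g0).
by apply: eq_integral => t _; rewrite mulfK ?gt_eqF.
Qed.

End affine_substitution.

Section inversion.
Context {R : realType}.
Local Notation leb := (@lebesgue_measure R).

(** On each half line the inverse is a power function up to signs; the value 0 at
    0 agrees with the first branch. *)
Lemma measurable_invr : measurable_fun setT (@GRing.inv R : measurableTypeR R -> measurableTypeR R).
Proof.
rewrite (_ : GRing.inv = fun x : R =>
    if 0 <= x then x `^ (-1) else - ((- x) `^ (-1))).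
  apply: measurable_fun_ifT => //.
  - by apply: (measurable_fun_ler (measurable_cst _)).
  - apply: measurableT_comp => //.
    apply: (measurableT_comp (measurable_powR _)).
    exact: oppr_measurable.
apply/funext => x; case: ifPn => x0; first by rewrite powR_inv1.
by rewrite powR_inv1 ?invrN ?opprK// oppr_ge0 ltW// ltNge.
Qed.

(** The Jacobian of the inversion of the positive half line. *)
Let dens (s : measurableTypeR R) : R := (0 < s)%R%:R * s ^- 2.

Let dens_ge0 s : 0 <= dens s.
Proof. by rewrite mulr_ge0// invr_ge0 exprn_even_ge0. Qed.

Let measurable_dens : measurable_fun setT dens.
Proof.
apply: measurable_funM; last first.
  apply: (measurableT_comp measurable_invr).
  exact: exprn_measurable.
rewrite (_ : (fun s : R => _) = \1_(`]0, +oo[ : set R)).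
  exact: measurable_indic.
apply/funext => s; rewrite indicE; congr (_%:R).
by rewrite mem_setE in_itv/= andbT.
Qed.

Local Open Scope ereal_scope.

Let dmeas (A : set (measurableTypeR R)) := \int[leb]_(s in A) (dens s)%:E.

Let dmeas0 : dmeas set0 = 0.
Proof. by rewrite /dmeas integral_set0. Qed.

Let dmeas_ge0 A : 0 <= dmeas A.
Proof. by apply: integral_ge0 => s _; rewrite lee_fin. Qed.

Let dmeas_sigma : semi_sigma_additive dmeas.
Proof.
apply: semi_sigma_additive_nng_induced.
  exact/measurable_EFinP.
by move=> s; rewrite lee_fin.
Qed.

HB.instance Definition _ :=
  isMeasure.Build _ _ _ dmeas dmeas0 dmeas_ge0 dmeas_sigma.

Let integral_inv_sqr (c : R) : (0 < c)%R ->
  \int[leb]_(s in `[c, +oo[) (s ^- 2)%:E = c^-1%:E.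
Proof.
move=> c0.
have dF (x : R) : (0 < x)%R -> is_derive x (1%R : R) (fun s : R => - s^-1)%R (x ^- 2)%R.
  move=> x0.
  have xn0 : x != 0%R by rewrite gt_eqF.
  apply: DeriveDef.
    by apply: derivableN; apply: derivableV.
  rewrite deriveN ?deriveV//; last exact: derivableV.
  by rewrite derive_id scaleNr opprK /GRing.scale/= mulr1.
rewrite (@ge0_continuous_FTC2y _ _ (fun s => - s^-1)%R _ 0%R).
- by rewrite EFinN oppeK add0e.
- by move=> x cx; rewrite invr_ge0 exprn_ge0// (le_trans _ cx)// ltW.
- apply: continuous_in_subspaceT => x; rewrite inE/= in_itv/= andbT => cx.
  have x0 : (0 < x)%R by exact: lt_le_trans cx.
  apply: cvgV; first by rewrite expf_neq0// gt_eqF.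
  exact: exprn_continuous.
- rewrite -oppr0; apply: cvgN; apply/gtr0_cvgV0.
    by near=> x; near: x; exact: nbhs_pinfty_gt.
  exact: cvg_id.
- by move=> x cx; have [] := dF x (lt_trans c0 cx).
- apply: cvg_at_right_filter; apply: cvgN; apply: cvgV; first by rewrite gt_eqF.
  exact: cvg_id.
- move=> x; rewrite in_itv/= andbT => cx.
  by rewrite derive1E; have [_ ->] := dF x (lt_trans c0 cx).
Unshelve. all: by end_near. Qed.

Let dmeas_preimage_le (b : R) :
  dmeas (GRing.inv @^-1` `]-oo, b]%classic) = (Num.max b 0)%:E.
Proof.
have mpre A : measurable A -> measurable ((GRing.inv : R -> R) @^-1` A).
  by move=> mA; rewrite -[X in measurable X]setTI; apply: measurable_invr.
have [b0|b0] := leP b 0%R.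
  rewrite /dmeas; apply: integral0_eq => s; rewrite /= in_itv/= => sb.
  rewrite /dens; case: ltP; rewrite ?mul0r// => s0.
  by have := le_trans sb b0; rewrite invr_le0 leNgt s0.
rewrite -[b in RHS]invrK -integral_inv_sqr ?invr_gt0//.
rewrite /dmeas integral_mkcond [RHS]integral_mkcond.
apply: eq_integral => s _; rewrite !patchE /dens.
have [s0|s0] := ltP 0%R s; last first.
  rewrite mul0r [in RHS]ifF; last first.
    apply/negbTE; rewrite notin_setE/= in_itv/= andbT; apply/negP.
    by rewrite -ltNge (le_lt_trans s0)// invr_gt0.
  by case: ifP.
rewrite mul1r; congr (if _ then _ else _).
rewrite !mem_setE /= in_itv/= andbT.
by rewrite -[LHS]/(s^-1 \in `]-oo, b])%R in_itv/= -lef_pV2 ?posrE ?invr_gt0// invrK.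
Qed.

(** The Lebesgue measure is rebuilt from its restriction to the nonpositive half
    line and the image of the measure of density [dens] under inversion.  The two
    measures are compared on intervals, where the second part is an explicit
    improper integral. *)
Let lebesgue_inversion A : measurable A ->
  leb A = leb (A `&` `]-oo, 0%R]) + dmeas (GRing.inv @^-1` A).
Proof.
move=> mA; have mN : measurable (`]-oo, 0%R]%classic : set (measurableTypeR R)) by [].
pose nu2 := image_measure (dmeas : {measure set _ -> \bar R}) measurable_invr.
pose nu := measure_add (mrestr leb mN) nu2.
have nuE B : nu B = leb (B `&` `]-oo, 0%R]) + nu2 B by exact: measure_addE.
have -> : leb (A `&` `]-oo, 0%R]) + dmeas (GRing.inv @^-1` A) = nu A.
  exact/esym/nuE.
apply: lebesgue_measure_unique => // _ [[a b]] _ <-.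
rewrite -[RHS]/(nu `]a, b]%classic) -[LHS]/(leb `]a, b]%classic) nuE.
have [ba|ab] := leP b a.
  by rewrite set_itv_ge ?bnd_simp -?leNgt// set0I !measure0 adde0.
have nu2E : nu2 `]a, b]%classic = (Num.max b 0 - Num.max a 0)%:E.
  have : nu2 `]-oo, b]%classic = nu2 `]-oo, a]%classic + nu2 `]a, b]%classic.
    rewrite -measureU//.
      by rewrite -itv_bndbnd_setU ?bnd_simp// ltW.
    apply/seteqP; split => // t [] /=; rewrite !in_itv/= => ta /andP[+ _].
    by rewrite ltNge ta.
  rewrite {1 2}/nu2/= /pushforward !dmeas_preimage_le => E.
  have : (Num.max b 0)%:E - (Num.max a 0)%:E = nu2 `]a, b]%classic.
    by rewrite E [X in X - _]addeC addeK.
  by rewrite EFinB.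
rewrite nu2E (_ : _ `&` _ = `]a, Num.min b 0%R]%classic); last first.
  apply/seteqP; split => t /=; rewrite !in_itv/= le_min.
    by move=> [/andP[-> ->] ->].
  by move=> /andP[-> /andP[-> ->]].
rewrite !lebesgue_measure_itv/= !lte_fin ab lt_min ab/= -EFinB.
have [a0|a0] := ltP a 0%R; have [b0|b0] := ltP b 0%R; rewrite -?EFinD ?add0e.
- by congr EFin; lra.
- by congr EFin; lra.
- by have := lt_trans (le_lt_trans a0 ab) b0; rewrite ltxx.
- by congr EFin; lra.
Qed.

(** Inversion being an involution, the law of the inverse under the Lebesgue
    measure on the positive half line, applied to [f] composed with inversion,
    gives the formula in this direction. *)
Lemma ge0_integral_inversion (f : measurableTypeR R -> R) :
  measurable_fun setT f -> (forall t, 0 <= f t)%R ->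
  \int[leb]_t (f t^-1 * ((0 < t)%R%:R * t ^- 2))%:E =
  \int[leb]_t (f t * (0 < t)%R%:R)%:E.
Proof.
move=> mf f0.
have mpos : measurable (`]0%R, +oo[%classic : set (measurableTypeR R)) by [].
have law (A : set (measurableTypeR R)) : measurable A -> leb (`]0%R, +oo[ `&` (GRing.inv : measurableTypeR R -> measurableTypeR R) @^-1` A) =
    \int[leb]_(y in A) (dens y)%:E.
  move=> mA; have mpre : measurable ((GRing.inv : measurableTypeR R -> measurableTypeR R) @^-1` A).
    by rewrite -[X in measurable X]setTI; apply: measurable_invr.
  rewrite lebesgue_inversion; last exact: measurableI.
  rewrite (_ : _ `&` `]-oo, 0%R]%classic = set0) ?measure0 ?add0e; last first.
    apply/seteqP; split => // t [] [] /=; rewrite !in_itv/= andbT => t0 _.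
    by rewrite leNgt t0.
  rewrite /dmeas integral_mkcond [RHS]integral_mkcond.
  apply: eq_integral => s _; rewrite !patchE /dens.
  have [s0|s0] := ltP 0%R s; last by rewrite mul0r; do 2 case: ifP.
  congr (if _ then _ else _).
  apply/idP/idP; rewrite !inE /= in_itv/= andbT invrK invr_gt0.
    by move=> [].
  by [].
have mg : measurable_fun setT (fun t : measurableTypeR R => f (t^-1)%R).
  exact: (measurableT_comp mf measurable_invr).
have g0 (t : measurableTypeR R) : (0 <= f (t^-1)%R)%R by [].
rewrite -[LHS](ge0_integral_transfer mpos measurable_invr measurable_dens
  dens_ge0 law mg g0).
rewrite integral_mkcond; apply: eq_integral => t _; rewrite patchE invrK.
rewrite mem_setE in_itv/= andbT.
by case: ifP; rewrite ?mulr1 ?mulr0.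
Qed.

End inversion.

(** * Gaussian and inverse gamma integrals *)

Section one_dimensional_integrals.
Context {R : realType}.
Local Notation leb := (@lebesgue_measure R).
Local Open Scope ereal_scope.

Lemma measurable_gt0 d (T : measurableType d) (f : T -> measurableTypeR R) :
  measurable_fun setT f ->
  measurable_fun setT (fun x => (0 < f x)%R%:R : measurableTypeR R).
Proof.
move=> mf; have mi : measurable_fun setT (\1_(`]0%R, +oo[%classic) : measurableTypeR R -> R).
  exact: measurable_indic.
rewrite (_ : (fun x => _) = \1_(`]0%R, +oo[%classic) \o f).
  exact: measurableT_comp.
by apply/funext => x /=; rewrite indicE mem_setE in_itv/= andbT.
Qed.

Lemma integral_half_gauss :
  \int[leb]_t (expR (- (1 / 2) * t ^+ 2))%:E = ((2 * pi) `^ (1 / 2))%:E.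
Proof.
pose r : R := Num.sqrt 2; have r0 : (0 < r)%R by rewrite sqrtr_gt0.
have := @integralT_gauss R.
rewrite -(@ge0_integral_affine _ (r^-1)%R 0%R) ?invr_gt0//.
- under eq_integral do rewrite EFinM muleC.
  rewrite ge0_integralZl//; last 3 first.
  + apply/measurable_EFinP.
    apply: (measurableT_comp (@measurable_gauss_fun R)).
    by apply: measurable_funD => //; exact: measurable_funM.
  + by move=> t _; rewrite lee_fin gauss_fun_ge0.
  + by rewrite lee_fin invr_ge0 ltW.
  move=> /(congr1 (fun y => r%:E * y)).
  rewrite muleA -EFinM mulfV ?gt_eqF// mul1e -EFinM => E.
  rewrite div1r powR12_sqrt ?mulr_ge0 ?pi_ge0// sqrtrM// -E.
  apply: eq_integral => t _; rewrite /gauss_fun addr0 exprMn exprVn.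
  by rewrite sqr_sqrtr// mulNr.
- exact: measurable_gauss_fun.
- exact: gauss_fun_ge0.
Qed.

(** Inversion turns the integrand into a gamma integrand, rescaled by [c / 2].
    The hypothesis [Gamma a != 0] stands for convergence: [Gamma] is the real
    part of an extended integral, which is 0 when that integral diverges. *)
Lemma integral_inverse_gamma (a c : R) : (0 < c)%R -> Gamma a != 0%R ->
  \int[leb]_t ((0 < t)%R%:R * (t `^ (- (a + 1)) * expR (- (1 / 2) * (t^-1 * c))))%:E =
  ((c / 2) `^ (- a) * Gamma a)%:E.
Proof.
move=> c0 G0.
have c20 : (0 < c / 2)%R by rewrite divr_gt0.
pose h (t : measurableTypeR R) : R := ((0 < t)%R%:R * (t `^ (a - 1) * expR (- t)))%R.
pose f (t : measurableTypeR R) : R :=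
  ((0 < t)%R%:R * (t `^ (a - 1) * expR (- (c / 2 * t))))%R.
have mh : measurable_fun setT h.
  apply: measurable_funM; first exact: (measurable_gt0 (f := id)).
  apply: measurable_funM; first exact: measurable_powR.
  by apply: measurableT_comp => //; exact: oppr_measurable.
have mf : measurable_fun setT f.
  apply: measurable_funM; first exact: (measurable_gt0 (f := id)).
  apply: measurable_funM; first exact: measurable_powR.
  apply: measurableT_comp => //; apply: measurableT_comp; first exact: oppr_measurable.
  exact: measurable_funM.
have f0 t : (0 <= f t)%R by rewrite !mulr_ge0 ?powR_ge0 ?expR_ge0.
have h0 t : (0 <= h t)%R by rewrite !mulr_ge0 ?powR_ge0 ?expR_ge0.
have hG : \int[leb]_t (h t)%:E = (Gamma a)%:E.
  have -> : \int[leb]_t (h t)%:E =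
      \int[leb]_(t in `]0%R, +oo[) (t `^ (a - 1) * expR (- t))%:E.
    rewrite [RHS]integral_mkcond; apply: eq_integral => t _.
    rewrite patchE mem_setE in_itv/= andbT /h.
    by case: ifP; rewrite ?mul1r ?mul0r.
  (* A divergent gamma integral would have real part 0. *)
  rewrite /Gamma /Rintegral fineK// ge0_fin_numE; last first.
    by apply: integral_ge0 => t _; rewrite lee_fin mulr_ge0 ?powR_ge0 ?expR_ge0.
  rewrite ltey; apply: contra G0 => /eqP E.
  by rewrite /Gamma /Rintegral E.
have fE : \int[leb]_t (f t)%:E = ((c / 2) `^ (- a) * Gamma a)%:E.
  have mhc : measurable_fun setT
      (fun t : measurableTypeR R => (h (c / 2 * t + 0) * (c / 2))%R).
    apply: (@measurable_funM _ _ _ setT (fun t => h (c / 2 * t + 0))%R (cst (c / 2)%R)) => //.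
    apply: (measurableT_comp mh).
    by apply: measurable_funD => //; exact: measurable_funM.
  rewrite EFinM -hG -[X in _ = _ * X](ge0_integral_affine 0%R c20)//.
  rewrite -ge0_integralZl//; last 3 first.
  - exact/measurable_EFinP.
  - by move=> t _; rewrite lee_fin mulr_ge0// ltW.
  - by rewrite lee_fin powR_ge0.
  apply: eq_integral => t _; rewrite -EFinM /f /h addr0; congr EFin.
  rewrite pmulr_rgt0//; have [t0|t0] := ltP 0%R t; last by rewrite !mul0r mulr0.
  have key : ((c / 2) `^ (- a) * (c / 2) `^ (a - 1) * (c / 2) = 1)%R.
    rewrite -[X in (_ * X = _)%R](powRr1 (ltW c20)) -!powRD; last 2 first.
      by rewrite (gt_eqF c20) implybT.
      by rewrite (gt_eqF c20) implybT.
    by rewrite (_ : - a + (a - 1) + 1 = 0)%R ?powRr0//; ring.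
  rewrite !mul1r [((_ * t) `^ _)%R]powRM ?ltW//.
  by rewrite -[LHS]mul1r -[X in (X * _ = _)%R]key; ring.
rewrite -fE.
transitivity (\int[leb]_t (f t * (0 < t)%R%:R)%:E); last first.
  apply: eq_integral => t _; rewrite /f; congr EFin.
  by case: ltP; rewrite ?mulr1 ?mul0r.
rewrite -ge0_integral_inversion//; apply: eq_integral => t _; congr EFin.
rewrite /f invr_gt0; have [t0|t0] := ltP 0%R t; last by rewrite !mul0r.
rewrite !mul1r mulrAC; congr (_ * expR _)%R; last by rewrite mulrCA; field; rewrite gt_eqF.
rewrite -powR_inv1 ?ltW// -powRrM -exprVn -powR_inv1 ?ltW// -powR_mulrn ?powR_ge0// -powRrM.
rewrite -powRD; last by rewrite (gt_eqF t0) implybT.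
by congr (_ `^ _)%R; lra.
Qed.

End one_dimensional_integrals.

(** * Positive definite matrices *)

Section positive_definite.
Context {R : realType}.

(** One step of elimination splits off the first row and column,
    leaving the Schur complement, whose positivity is tested on vectors that
    minimise the form in the first coordinate.  The triangular shape of [W] is
    what makes the new variables a triangular change of coordinates. *)
Lemma posdef_factor n (A : 'M[R]_n) : posdefmx A ->
  exists (W : 'M[R]_n) (d : 'rV[R]_n),
  [/\ forall i, W i i = 1, forall i j : 'I_n, (j < i)%N -> W i j = 0,
      forall i, 0 < d 0 i & A = W^T *m diag_mx d *m W].
Proof.
elim: n A => [|n IH] A [Asym Apos].
  exists 1%:M, 0; split; [by case|by case|by case|].
  by rewrite [LHS]flatmx0 [RHS]flatmx0.
pose a := A 0 0.
pose b : 'rV[R]_n := ursubmx (A : 'M[R]_(1 + n)).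
pose C : 'M[R]_n := drsubmx (A : 'M[R]_(1 + n)).
have AE : A = block_mx a%:M b b^T C :> 'M[R]_(1 + n).
  rewrite -[LHS](submxK (A : 'M[R]_(1 + n))); congr block_mx.
    by apply/matrixP => i j; rewrite !ord1 !mxE; congr (A _ _); apply/val_inj.
  by rewrite /b -{1}Asym; apply/matrixP => i j; rewrite !mxE.
have a0 : 0 < a.
  have := Apos (delta_mx 0 0) _.
  rewrite trmx_delta -rowE -colE !mxE; apply.
  by apply/eqP => /matrixP/(_ 0 0)/eqP; rewrite !mxE !eqxx oner_eq0.
have Apos' (u : 'cV[R]_(1 + n)) : u != 0 ->
    0 < (u^T *m block_mx a%:M b b^T C *m u) 0 0.
  by rewrite -AE; exact: Apos.
have Csym : C^T = C.
  rewrite /C -{2}Asym; apply/matrixP => i j; rewrite !mxE//.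
have [|W [d [W1 W0 d0 CE]]] := IH (C - a^-1 *: (b^T *m b)).
  split; first by rewrite linearB linearZ /= trmx_mul trmxK Csym.
  move=> v v0.
  (* the minimiser of the form in the first coordinate, given v *)
  pose u : 'cV[R]_(1 + n) := col_mx (- a^-1 *: (b *m v)) v.
  have := Apos' u.
  have -> : u != 0.
    apply: contra v0 => /eqP u0; apply/eqP.
    by rewrite -[v](col_mxKd (- a^-1 *: (b *m v))) -/u u0 linear0.
  move=> /(_ isT); rewrite /u tr_col_mx mul_row_block mul_row_col.
  rewrite mulmxBr mulmxBl.
  set x := (b *m v).
  have -> : v^T *m (b^T) = x^T by rewrite trmx_mul.
  rewrite -!scalemxAr -!scalemxAl !mulmxA.
  have -> : v^T *m b^T *m b *m v = x^T *m x by rewrite -mulmxA trmx_mul.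
  rewrite linearZ /= mul_mx_scalar scalerA mulrN mulfV ?gt_eqF// scaleN1r.
  rewrite addNr !mul0mx scaler0 add0r mulmxDl -!scalemxAl -/x.
  by rewrite -mulmxA -/x scaleNr addrC.
suff: exists (W : 'M[R]_(1 + n)) (d : 'rV[R]_(1 + n)),
  [/\ forall i : 'I_(1 + n), W i i = 1,
      forall i j : 'I_(1 + n), (j < i)%N -> W i j = 0,
      forall i : 'I_(1 + n), 0 < d 0 i &
      A = W^T *m diag_mx d *m W :> 'M[R]_(1 + n)] by [].
exists (block_mx 1%:M (a^-1 *: b) 0 W : 'M[R]_(1 + n)), (row_mx a%:M d : 'rV[R]_(1 + n)).
split.
- move=> i; case: (split_ordP i) => j ->.
    by rewrite block_mxEul ord1 mxE.
  by rewrite block_mxEdr.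
- move=> i j; case: (split_ordP i) => i' ->; case: (split_ordP j) => j' ->.
  + by rewrite !ord1.
  + by rewrite !ord1.
  + by move=> _; rewrite block_mxEdl mxE.
  + by rewrite block_mxEdr ltn_add2l; exact: W0.
- move=> i; case: (split_ordP i) => j ->.
    by rewrite row_mxEl ord1 mxE.
  by rewrite row_mxEr.
- rewrite [LHS]AE tr_block_mx diag_mx_row !mulmx_block.
  rewrite !trmx1 !trmx0 !mul0mx !mulmx0 !mul1mx !addr0 !add0r !mulmx1.
  have -> : diag_mx (a%:M : 'M[R]_1) = a%:M :> 'M[R]_1.
    by apply/matrixP => i j; rewrite !ord1 !mxE.
  congr block_mx.
  + by rewrite mul0mx addr0 mul_scalar_mx scalerA mulfV ?gt_eqF// scale1r.
  + by rewrite linearZ/= mul_mx_scalar scalerA mulfV ?gt_eqF// scale1r.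
  + rewrite -CE linearZ/= [(_ *: b)^T]linearZ/= mul_mx_scalar scalerA.
    by rewrite mulfV ?gt_eqF// scale1r addrCA subrr addr0.
Qed.

Lemma posdef_det n (A W : 'M[R]_n) (d : 'rV[R]_n) :
  (forall i, W i i = 1) -> (forall i j : 'I_n, (j < i)%N -> W i j = 0) ->
  A = W^T *m diag_mx d *m W -> \det A = \prod_i d 0 i.
Proof.
move=> W1 W0 ->.
have W1' : \det W = 1.
  rewrite -det_tr det_trig; last first.
    by apply/is_trig_mxP => i j ij; rewrite mxE W0.
  by rewrite big1// => i _; rewrite mxE.
by rewrite !det_mulmx det_tr W1' det_diag mul1r mulr1.
Qed.

Lemma posdef_det_gt0 n (A : 'M[R]_n) : posdefmx A -> 0 < \det A.
Proof.
move=> /posdef_factor [W [d [W1 W0 d0 /(posdef_det W1 W0) ->]]].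
by rewrite prodr_gt0.
Qed.

Lemma posdef_unit n (A : 'M[R]_n) : posdefmx A -> A \in unitmx.
Proof.
by move=> /posdef_det_gt0 dA; rewrite unitmxE unitfE gt_eqF.
Qed.

(** The determinant of the block matrix with rows [1, - s y^T] and [y, M] is
    computed by eliminating either of the two diagonal blocks. *)
Lemma det_rank1_update n (M : 'M[R]_n) (y : 'cV[R]_n) (s : R) : M \in unitmx ->
  \det (M + s *: (y *m y^T)) = \det M * (1 + s * (y^T *m invmx M *m y) 0 0).
Proof.
move=> uM.
pose B : 'M[R]_(1 + n) := block_mx 1%:M (- s *: y^T) y M.
have detB1 : \det B = \det (M + s *: (y *m y^T)).
  have : block_mx 1%:M 0 (- y) 1%:M *m B =
      block_mx 1%:M (- s *: y^T) 0 (M + s *: (y *m y^T)).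
    rewrite mulmx_block !mul0mx !mul1mx !addr0 mulmx1 addNr; congr block_mx.
    by rewrite -scalemxAr mulNmx scalerN scaleNr opprK addrC.
  by move=> /(congr1 determinant); rewrite det_mulmx det_lblock det_ublock !det1 !mul1r.
rewrite -detB1.
have : B *m block_mx 1%:M 0 (- (invmx M *m y)) 1%:M =
    block_mx (1%:M + s *: (y^T *m invmx M *m y)) (- s *: y^T) 0 M.
  rewrite mulmx_block !mulmx0 !mulmx1 !add0r; congr block_mx.
    by rewrite mulmxN -scalemxAl scaleNr opprK mulmxA.
  by rewrite mulmxN mulmxA mulmxV// mul1mx subrr.
move=> /(congr1 determinant); rewrite det_mulmx det_lblock det_ublock !det1 !mulr1.
by move=> ->; rewrite mulrC; congr (_ * _); rewrite det_mx11 !mxE.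
Qed.

End positive_definite.

(** * Principal submatrices through selection matrices *)

Section selection.
Context {R : realType} {p : nat}.
Implicit Types (A : 'M[R]_p) (S : {set 'I_p}) (i : 'I_p).

(** The rows of the identity matrix indexed by [S]: restriction to [S] as a
    matrix, so that submatrices, subvectors and padding become products. *)
Definition selmx S : 'M[R]_(#|S|, p) :=
  \matrix_(k, j) (enum_val k == j)%:R.

Lemma selmx_mul n S (M : 'M[R]_(p, n)) :
  selmx S *m M = \matrix_(k, j) M (enum_val k) j.
Proof.
apply/matrixP => k j; rewrite !mxE (bigD1 (enum_val k))//= mxE eqxx mul1r.
by rewrite big1 ?addr0// => i; rewrite mxE eq_sym => /negbTE ->; rewrite mul0r.
Qed.

Lemma mul_tr_selmx n S (M : 'M[R]_(n, p)) :
  M *m (selmx S)^T = \matrix_(i, k) M i (enum_val k).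
Proof.
apply: trmx_inj; rewrite trmx_mul trmxK selmx_mul.
by apply/matrixP => i j; rewrite !mxE.
Qed.

Lemma selmxK S : selmx S *m (selmx S)^T = 1%:M.
Proof.
by rewrite mul_tr_selmx; apply/matrixP => k l; rewrite !mxE (inj_eq enum_val_inj).
Qed.

Lemma psubmxE A S : psubmx A S = selmx S *m A *m (selmx S)^T.
Proof.
by rewrite mul_tr_selmx selmx_mul; apply/matrixP => k l; rewrite !mxE.
Qed.

Lemma subcolE A S i : subcol A S i = selmx S *m A *m delta_mx i 0.
Proof. by rewrite -colE selmx_mul; apply/matrixP => k l; rewrite !mxE. Qed.

Lemma subrowE A S i : subrow A i S = delta_mx 0 i *m A *m (selmx S)^T.
Proof. by rewrite mul_tr_selmx -rowE; apply/matrixP => k l; rewrite !mxE. Qed.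

Lemma padmxE S (B : 'M[R]_#|S|) : padmx B = (selmx S)^T *m B *m selmx S.
Proof.
apply/matrixP => i j; rewrite !mxE big_mkcond.
under [RHS]eq_bigr do rewrite !mxE mulr_suml.
rewrite [RHS]exchange_big /=; apply: eq_bigr => k _.
case: eqP => [<-|/eqP/negbTE ki]; last first.
  by rewrite big1// => l _; rewrite !mxE ki !mul0r.
rewrite big_mkcond; apply: eq_bigr => l _; rewrite !mxE eqxx mul1r.
by case: eqP; rewrite ?mulr1 ?mulr0.
Qed.

Lemma tr_selmx_mul_supp n S (M : 'M[R]_(#|S|, n)) i j : i \notin S ->
  ((selmx S)^T *m M) i j = 0.
Proof.
move=> iS; rewrite mxE big1// => k _; rewrite !mxE.
by case: eqP => [ki|]; [rewrite -ki enum_valP in iS|rewrite mul0r].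
Qed.

(** The product of the transposed selection with the selection is the projection
    on the coordinates in [S]. *)
Lemma tr_selmxK n S (M : 'M[R]_(p, n)) :
  (forall i j, i \notin S -> M i j = 0) ->
  (selmx S)^T *m (selmx S *m M) = M.
Proof.
move=> M0; apply/matrixP => i j; rewrite selmx_mul !mxE.
have [iS|iS] := boolP (i \in S); last first.
  rewrite M0// big1// => k _; rewrite !mxE.
  by case: eqP => [ki|]; [rewrite -ki enum_valP in iS|rewrite mul0r].
rewrite (bigD1 (enum_rank_in iS i))//= !mxE enum_rankK_in// eqxx mul1r.
rewrite big1 ?addr0// => k.
rewrite -(inj_eq enum_val_inj) enum_rankK_in// => /negbTE ki.
by rewrite !mxE ki mul0r.
Qed.

Lemma posdef_psubmx A S : posdefmx A -> posdefmx (psubmx A S).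
Proof.
move=> [As Ap]; rewrite psubmxE; split.
  by rewrite !trmx_mul trmxK As mulmxA.
move=> v v0; have := Ap ((selmx S)^T *m v).
rewrite trmx_mul trmxK !mulmxA; apply.
apply: contra v0 => /eqP sv; apply/eqP.
by rewrite -[v]mul1mx -(selmxK S) -mulmxA sv mulmx0.
Qed.

(** The unit vector of [i] minus the coefficients of the regression of variable
    [i] on those in [S], for a covariance [A]: the residual vector. *)
Definition regvec A i S : 'cV[R]_p :=
  delta_mx i 0 - (selmx S)^T *m invmx (psubmx A S) *m subcol A S i.

Lemma selmx_regvec A i S : psubmx A S \in unitmx ->
  selmx S *m A *m regvec A i S = 0.
Proof.
move=> uA; rewrite mulmxBr !mulmxA -subcolE -psubmxE.
by rewrite mulmxV// mul1mx subrr.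
Qed.

(** Conditional variance as the covariance of variable [i] with its residual. *)
Lemma condvar_regvec A i S : condvar A i S = ((delta_mx 0 i : 'rV[R]_p) *m A *m regvec A i S) 0 0.
Proof.
rewrite mulmxBr [RHS]mxE [X in _ + X]mxE !mulmxA -subrowE /condvar.
by congr (_ - _); rewrite -rowE -colE !mxE.
Qed.

(** The residual vector is characterised by its entries off [S] and by being
    orthogonal, for [A], to the variables in [S].  This lets conditional variances be
    computed by exhibiting a candidate. *)
Lemma regvec_unique A i S (w : 'cV[R]_p) : psubmx A S \in unitmx ->
  (forall k, k \notin S -> w k 0 = (k == i)%:R) -> i \notin S ->
  selmx S *m A *m w = 0 -> regvec A i S = w.
Proof.
move=> uA wS iS Aw.
pose v : 'cV[R]_p := delta_mx i 0 - w.
have vE : v = (selmx S)^T *m (selmx S *m v).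
  rewrite tr_selmxK// => k j kS; rewrite !ord1 !mxE eqxx andbT wS//.
  by rewrite subrr.
have : selmx S *m A *m v = subcol A S i by rewrite mulmxBr Aw subr0 subcolE.
rewrite {1}vE !mulmxA -psubmxE -mulmxA => /(congr1 (mulmx (invmx (psubmx A S)))).
rewrite mulKmx// => E.
by rewrite /regvec -mulmxA -E -vE /v opprB addrC subrK.
Qed.

(** A matrix supported on [S] that inverts [A] on the rows of [S] is the padded
    inverse: its compression to [S] is a right inverse of the submatrix. *)
Lemma padinv_unique A S (Y : 'M[R]_p) : 
  (forall i j, i \notin S -> Y i j = 0) -> (forall i j, j \notin S -> Y i j = 0) ->
  selmx S *m A *m Y = selmx S -> padmx (invmx (psubmx A S)) = Y.
Proof.
move=> Y0 Y0' AY.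
have YE : (selmx S)^T *m (selmx S *m Y *m (selmx S)^T) *m selmx S = Y.
  rewrite mulmxA tr_selmxK//.
  apply: trmx_inj; rewrite !trmx_mul trmxK tr_selmxK// => i j iS.
  by rewrite mxE Y0'.
set B := selmx S *m Y *m (selmx S)^T in YE; clearbody B.
have AB : psubmx A S *m B = 1%:M.
  transitivity (selmx S *m A *m ((selmx S)^T *m B *m selmx S) *m (selmx S)^T).
    by rewrite psubmxE -!mulmxA selmxK mulmx1.
  by rewrite YE AY selmxK.
rewrite padmxE (_ : invmx _ = B)// -[RHS](mulKmx (mulmx1_unit AB).1).
by rewrite AB mulmx1.
Qed.

End selection.

(** * Schur complements and rank one updates *)

Section schur_complement.
Context {R : realType} {p : nat}.
Implicit Types (A : 'M[R]_p) (S : {set 'I_p}) (i : 'I_p).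

Definition padinv A S : 'M[R]_p := padmx (invmx (psubmx A S)).

Lemma regvecE A i S : regvec A i S = delta_mx i 0 - padinv A S *m A *m delta_mx i 0.
Proof. by rewrite /regvec /padinv padmxE subcolE !mulmxA. Qed.

Lemma selmx_padinv A S : psubmx A S \in unitmx ->
  selmx S *m A *m padinv A S = selmx S.
Proof. by move=> uA; rewrite /padinv padmxE !mulmxA -psubmxE mulmxV// mul1mx. Qed.

Lemma padinv_supp A S k l : k \notin S -> padinv A S k l = 0.
Proof. by move=> kS; rewrite /padinv padmxE -mulmxA tr_selmx_mul_supp. Qed.

Lemma regvec_supp A i S k : k \notin S -> regvec A i S k 0 = (k == i)%:R.
Proof.
move=> kS; rewrite /regvec -mulmxA mxE [X in _ + X]mxE.
by rewrite tr_selmx_mul_supp// subr0 mxE eqxx andbT.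
Qed.

Lemma tr_padinv A S : A^T = A -> (padinv A S)^T = padinv A S.
Proof.
move=> As; rewrite /padinv padmxE !trmx_mul trmxK trmx_inv mulmxA.
congr (_ *m invmx _ *m _).
by rewrite psubmxE !trmx_mul trmxK As mulmxA.
Qed.

(** Pythagoras for the form [A]: the cross terms vanish because [w] is orthogonal to
    every vector supported on [S]. *)
Lemma orthogonal_quadratic A S (w : 'cV[R]_p) (d : 'cV[R]_#|S|) :
  A^T = A -> selmx S *m A *m w = 0 ->
  (w + (selmx S)^T *m d)^T *m A *m (w + (selmx S)^T *m d) =
  w^T *m A *m w + d^T *m psubmx A S *m d.
Proof.
move=> As Aw.
have wA : w^T *m A *m (selmx S)^T = 0.
  by apply: trmx_inj; rewrite !trmx_mul !trmxK As mulmxA Aw trmx0.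
rewrite [(_ + _)^T]linearD /= mulmxDl mulmxDl !mulmxDr.
rewrite (mulmxA (w^T *m A)) wA mul0mx addr0 trmx_mul trmxK; congr (_ + _).
rewrite -[X in X + _]mulmxA -[X in X + _]mulmxA (mulmxA _ A) Aw mulmx0 add0r.
by rewrite psubmxE !mulmxA.
Qed.

Section quadratic.
Variables (A : 'M[R]_p) (pA : posdefmx A) (S : {set 'I_p}) (i : 'I_p).
Hypothesis iS : i \notin S.

Let As : A^T = A := pA.1.

Lemma psubmx_unit : psubmx A S \in unitmx.
Proof. exact/posdef_unit/posdef_psubmx. Qed.

Let uA := psubmx_unit.
Let w := regvec A i S.

Let Aw : selmx S *m A *m w = 0 := selmx_regvec i uA.

Let wAw : w^T *m A *m w = (condvar A i S)%:M.
Proof.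
rewrite [LHS]mx11_scalar condvar_regvec; congr (_ 0 0)%:M.
pose m := - (invmx (psubmx A S) *m subcol A S i).
have {1}-> : w = delta_mx i 0 + (selmx S)^T *m m by rewrite mulmxN mulmxA.
rewrite [(_ + _)^T]linearD /= trmx_mul trmxK trmx_delta !mulmxDl.
by rewrite -!(mulmxA m^T) Aw mulmx0 addr0.
Qed.

(** Completion of the square in the coordinates of [S]: the residual vector is
    the minimiser and the conditional variance the minimum. *)
Lemma quadratic_complete (l : 'cV[R]_#|S|) :
  let u : 'cV[R]_p := delta_mx i 0 + (selmx S)^T *m l in
  let d := l + invmx (psubmx A S) *m subcol A S i in
  (u^T *m A *m u) 0 0 = condvar A i S + (d^T *m psubmx A S *m d) 0 0.
Proof.
move=> u d.
have -> : u = w + (selmx S)^T *m d.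
  by rewrite /u /w /d /regvec mulmxDr mulmxA addrA addrAC subrK.
rewrite orthogonal_quadratic// wAw mxE; congr (_ + _).
by rewrite mxE eqxx mulr1n.
Qed.

Lemma condvar_gt0 : 0 < condvar A i S.
Proof.
have <- : (w^T *m A *m w) 0 0 = condvar A i S by rewrite wAw mxE eqxx mulr1n.
apply: pA.2; apply/eqP => /matrixP/(_ i 0)/eqP.
by rewrite regvec_supp// eqxx mxE oner_eq0.
Qed.

(** Inverse of a bordered matrix: enlarging the index set by [i] adds the rank one
    matrix of the residual vector over the conditional variance. *)
Lemma padinv_insert : padinv A (i |: S) =
  padinv A S + (condvar A i S)^-1 *: (w *m w^T).
Proof.
set X := padinv A S; set c := condvar A i S.
have c0 : c != 0 by rewrite gt_eqF// condvar_gt0.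
apply: padinv_unique.
- move=> k l; rewrite !inE negb_or => /andP[ki kS].
  rewrite mxE padinv_supp// add0r mxE mxE big1 ?mulr0// => j _.
  by rewrite !ord1 /w regvec_supp// (negbTE ki) mul0r.
- move=> k l; rewrite !inE negb_or => /andP[li lS].
  rewrite mxE -[X]trmxK /X tr_padinv// mxE padinv_supp// add0r mxE mxE big1 ?mulr0// => j _.
  by rewrite !ord1 [w^T _ _]mxE /w regvec_supp// (negbTE li) mulr0.
have rowS : selmx S *m (A *m (X + c^-1 *: (w *m w^T))) = selmx S.
  rewrite mulmxDr mulmxDr !mulmxA selmx_padinv// -scalemxAr.
  by rewrite !mulmxA Aw mul0mx scaler0 addr0.
(* On row i the rank one term supplies exactly what the first term lacks: the
   residual vector pairs with row i of A to the conditional variance. *)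
have rowi : (delta_mx 0 i : 'rV[R]_p) *m (A *m (X + c^-1 *: (w *m w^T))) = delta_mx 0 i.
  rewrite mulmxDr mulmxDr -!scalemxAr !mulmxA.
  have -> : (delta_mx 0 i : 'rV[R]_p) *m A *m w = c%:M.
    by rewrite [LHS]mx11_scalar -condvar_regvec.
  rewrite mul_scalar_mx scalerA mulVf// scale1r.
  rewrite /w regvecE linearB /= trmx_delta addrC -/X.
  by rewrite -addrA !trmx_mul trmx_delta As tr_padinv// !mulmxA addNr addr0.
apply/matrixP => k j.
rewrite -mulmxA selmx_mul mxE [RHS]mxE.
have := enum_valP k; rewrite !inE => /orP[/eqP ki|kS].
  have /matrixP/(_ 0 j) := rowi; rewrite -rowE !mxE ki => ->.
  by rewrite eqxx eq_sym.
have /matrixP/(_ (enum_rank_in kS (enum_val k)) j) := rowS.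
by rewrite selmx_mul mxE [in X in _ = X]mxE enum_rankK_in.
Qed.

End quadratic.

Section rank1.
Variables (A : 'M[R]_p) (pA : posdefmx A) (v : 'cV[R]_p) (s : R) (s0 : 0 <= s).
Variables (S : {set 'I_p}) (i : 'I_p).
Hypothesis iS : i \notin S.

Let As : A^T = A := pA.1.
Let B := A + s *: (v *m v^T).
Let X := padinv A S.
Let w := regvec A i S.
Let q := (v^T *m X *m v) 0 0.
Let t := (v^T *m w) 0 0.

Lemma posdef_rank1 : posdefmx B.
Proof.
split; first by rewrite /B linearD linearZ /= trmx_mul trmxK As.
move=> u u0; rewrite mulmxDr mulmxDl mxE ltr_pwDl ?pA.2//.
rewrite -scalemxAr -scalemxAl mxE mulr_ge0//.
rewrite (mulmxA u^T) -(mulmxA _ v^T) mxE big_ord1.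
rewrite (_ : (u^T *m v) 0 0 = (v^T *m u) 0 0); first by rewrite -expr2 sqr_ge0.
by rewrite -[in RHS](trmxK u) -trmx_mul [RHS]mxE.
Qed.

Lemma padinv_quad_ge0 : 0 <= q.
Proof.
have uA := psubmx_unit pA S.
have -> : q = ((X *m v)^T *m A *m (X *m v)) 0 0.
  rewrite /q trmx_mul /X tr_padinv// !mulmxA; congr (_ 0 0).
  congr (_ *m v); rewrite -!mulmxA; congr (_ *m _).
  rewrite {1 2}/padinv padmxE -!mulmxA; congr (_ *m _); congr (_ *m _).
  by rewrite mulmxA selmx_padinv.
have [->|/pA.2/ltW//] := eqVneq (X *m v) 0.
by rewrite mulmx0 mxE.
Qed.

Lemma det_psubmx_rank1 : \det (psubmx B S) = \det (psubmx A S) * (1 + s * q).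
Proof.
have -> : psubmx B S = psubmx A S + s *: ((selmx S *m v) *m (selmx S *m v)^T).
  by rewrite !psubmxE /B mulmxDr mulmxDl -scalemxAr -scalemxAl trmx_mul !mulmxA.
rewrite det_rank1_update ?psubmx_unit//; congr (_ * (1 + s * _)).
by rewrite /q /X /padinv padmxE trmx_mul !mulmxA.
Qed.

(** The residual vector of the updated matrix is the old one minus a multiple of
    [padinv A S *m v]; orthogonality to [S] fixes the multiple [t'], and the
    conditional variance is read off from the new residual vector. *)
Lemma condvar_rank1 : condvar B i S = condvar A i S + s * t ^+ 2 / (1 + s * q).
Proof.
have uA := psubmx_unit pA S.
have uB := psubmx_unit posdef_rank1 S.
have q0 := padinv_quad_ge0.
have sq0 : 1 + s * q != 0 by rewrite gt_eqF// ltr_pwDl// mulr_ge0.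
pose t' := s * t / (1 + s * q).
have qE : v^T *m X *m v = q%:M by rewrite [LHS]mx11_scalar.
have t'E : s * t - t' - s * (t' * q) = 0 by rewrite /t'; field.
have [w' w'E] : exists w', w' = w by exists w.
have tE : v^T *m w' = t%:M by rewrite w'E [LHS]mx11_scalar.
have selw : selmx S *m A *m w' = 0 by rewrite w'E; exact: selmx_regvec.
have cE : (delta_mx 0 i : 'rV[R]_p) *m A *m w' = (condvar A i S)%:M.
  by rewrite w'E [LHS]mx11_scalar -condvar_regvec.
have eAX : (delta_mx 0 i : 'rV[R]_p) *m A *m X *m v = (v i 0 - t)%:M.
  have -> : (delta_mx 0 i : 'rV[R]_p) *m A *m X = (delta_mx i 0 - w')^T.
    rewrite w'E /w regvecE opprB addrC subrK -/X !trmx_mul.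
    by rewrite trmx_delta As tr_padinv// mulmxA.
  rewrite -[LHS]trmxK trmx_mul trmxK mulmxBr tE [LHS]mx11_scalar.
  by congr (_ %:M); rewrite -colE !mxE eqxx mulr1n.
have regE : regvec B i S = w' - t' *: (X *m v).
  apply: regvec_unique => //.
    move=> k kS; rewrite mxE [X in _ + X]mxE [X in _ - X]mxE.
    rewrite [(X *m v) k 0]mxE big1 ?mulr0 ?subr0 ?w'E ?regvec_supp// => j _.
    by rewrite padinv_supp// mul0r.
  rewrite mulmxBr /B !mulmxDr !mulmxDl selw add0r -!scalemxAr -!scalemxAl.
  rewrite !mulmxA selmx_padinv//.
  rewrite -(mulmxA _ _ w') tE -(mulmxA _ _ X) -(mulmxA _ _ v) qE.
  rewrite !mul_mx_scalar !scalerA opprD addrA -scalerBl -scalerBl.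
  by rewrite -mulrA mulrCA t'E scale0r.
rewrite condvar_regvec regE mulmxBr /B !mulmxDr !mulmxDl.
rewrite -!scalemxAr -!scalemxAl !mulmxA cE eAX.
rewrite -(mulmxA _ _ w') tE -(mulmxA _ _ X) -(mulmxA _ _ v) qE.
have -> : (delta_mx 0 i : 'rV[R]_p) *m v = (v i 0)%:M.
  by rewrite -rowE [LHS]mx11_scalar mxE.
rewrite -!scalar_mxM !scale_scalar_mx -!raddfD -raddfB mxE eqxx mulr1n.
have -> : s * t ^+ 2 / (1 + s * q) = t' * t by rewrite /t'; field.
rewrite -[RHS]addr0 -[X in _ = _ + X](mulr0 (v i 0)) -t'E.
by move: (v i 0) => y; ring.
Qed.

End rank1.
End schur_complement.

(** * Precision matrices of a directed acyclic graph *)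

Section precision_matrices.
Context {R : realType} {p : nat}.
Variable E : {set 'I_p * 'I_p}.
Hypothesis hE : parent_dag E.
Implicit Types (i j : 'I_p) (D L U : 'M[R]_p) (x : @RE R p E).

Lemma pa_lt i j : i \in pa E j -> (j < i)%N.
Proof. by rewrite inE => /andP[ij /hE.2]; apply. Qed.

Lemma pa_self j : j \notin pa E j.
Proof. by apply/negP => /pa_lt; rewrite ltnn. Qed.

Lemma mem_dag i j : ((i, j) \in E) = (i == j) || (i \in pa E j).
Proof. by rewrite inE; case: eqVneq => //= ->; rewrite hE.1. Qed.

Lemma entry_tnth x (k : 'I_#|E|) : entry x (enum_val k) = tnth x k.
Proof.
by rewrite /entry (big_pred1 k)// => l /=; rewrite (inj_eq enum_val_inj).
Qed.

Lemma entry_out x e : e \notin E -> entry x e = 0.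
Proof.
move=> eE; rewrite /entry big_pred0// => k; apply/negP => /eqP ke.
by rewrite -ke enum_valP in eE.
Qed.

Lemma entry_tupleE (f : 'I_#|E| -> R) (g : 'I_p * 'I_p -> R) e : e \in E ->
  (forall k, f k = g (enum_val k)) ->
  entry ([tuple f k | k < #|E|] : @RE R p E) e = g e.
Proof.
move=> eE fg; rewrite -(enum_rankK_in eE eE) entry_tnth tnth_mktuple.
exact: fg.
Qed.

Lemma theta_coordE D L i j :
  entry (theta_coord E D L) (i, j) =
  if i == j then D i i else if (i, j) \in E then L i j else 0.
Proof.
have [ijE|ijE] := boolP ((i, j) \in E); last first.
  by rewrite entry_out//; case: eqP ijE => // ->; rewrite hE.1.
rewrite (entry_tupleE (g := fun e => if e.1 == e.2 then D e.1 e.1 else L e.1 e.2))//=.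
Qed.

Lemma theta_coordK D L : Theta E (D, L) ->
  coordD (theta_coord E D L) = D /\ coordL (theta_coord E D L) = L.
Proof.
move=> th; have [/is_diag_mxP dD D0 [/is_trig_mxP tL L1 L0]] := th.
split; apply/matrixP => i j; rewrite !mxE theta_coordE//.
  by rewrite eqxx; case: eqVneq => [->|/dD ->]; rewrite ?mulr1n ?mulr0n.
case: eqVneq => [->|ij]; first by rewrite L1.
rewrite mem_dag (negbTE ij)/=; case: ifPn => // /L0 -> //.
Qed.

(** Positions outside [E] carry the value 0, so that the shape conditions hold for
    every point of the chart; only positivity of [D] is a constraint. *)
Lemma Theta_coord x : Theta E (coordD x, coordL x) <->
  forall i, 0 < entry x (i, i).
Proof.
split=> [[/= _ D0 _] i|x0]; first by have := D0 i; rewrite mxE eqxx mulr1n.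
split => /=.
- apply/is_diag_mxP => i j ij; rewrite mxE (_ : (i == j) = false) ?mulr0n//.
  exact: negbTE.
- by move=> i; rewrite mxE eqxx mulr1n.
- split.
  + apply/is_trig_mxP => i j ij; rewrite mxE.
    case: eqVneq ij => [->|ne ij]; first by rewrite ltnn.
    rewrite entry_out// mem_dag negb_or ne; apply/negP => /pa_lt ji.
    by have := ltn_trans ij ji; rewrite ltnn.
  + by move=> i; rewrite mxE eqxx.
  + by move=> i j ij ijp; rewrite mxE (negbTE ij) entry_out// mem_dag (negbTE ij).
Qed.

Section Theta.
Variables (D L : 'M[R]_p) (th : Theta E (D, L)).

Let D0 i : 0 < D i i. Proof. by have [_ /(_ i)] := th. Qed.
Let L1 i : L i i = 1. Proof. by have [_ _ [_ /(_ i)]] := th. Qed.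
Let L0 i j : i != j -> i \notin pa E j -> L i j = 0.
Proof. by have [_ _ [_ _]] := th; apply. Qed.
Let tL i j : (i < j)%N -> L i j = 0.
Proof. by have [_ _ [/is_trig_mxP h _ _]] := th; exact: h. Qed.

Lemma invmx_Theta_diag : invmx D = diag_mx (\row_i (D i i)^-1).
Proof.
have [/is_diag_mxP dD _ _] := th.
have DE : D = diag_mx (\row_i D i i).
  apply/matrixP => i j; rewrite !mxE.
  by case: eqVneq => [->|/dD ->]; rewrite ?mulr1n ?mulr0n.
have DV : D *m diag_mx (\row_i (D i i)^-1) = 1%:M.
  rewrite {1}DE mulmx_diag -diag_const_mx; congr diag_mx.
  by apply/rowP => i; rewrite !mxE divff// gt_eqF.
by rewrite -[RHS](mulKmx (mulmx1_unit DV).1) DV mulmx1.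
Qed.

Lemma Theta_unitD : D \in unitmx.
Proof.
have [/is_diag_mxP dD _ _] := th.
rewrite unitmxE unitfE det_trig.
  by rewrite gt_eqF// prodr_gt0.
by apply/is_trig_mxP => i j ij; apply: dD; case: eqVneq ij => // ->; rewrite ltnn.
Qed.

Lemma Theta_unitL : L \in unitmx.
Proof.
rewrite unitmxE unitfE det_trig; last by apply/is_trig_mxP => i j; exact: tL.
by rewrite big1 ?oner_eq0.
Qed.

(** A column of [L] has free coordinates on the parents only. *)
Lemma col_Theta j :
  col j L = delta_mx j 0 + (selmx (pa E j))^T *m (selmx (pa E j) *m col j L).
Proof.
have -> : selmx (pa E j) *m col j L = selmx (pa E j) *m (col j L - delta_mx j 0).
  rewrite mulmxBr -[X in _ = _ - X]colE; apply/esym/eqP.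
  rewrite subr_eq addrC -subr_eq subrr eq_sym; apply/eqP/matrixP => k l.
  rewrite !mxE; case: eqP => // kj.
  by have := enum_valP k; rewrite kj (negbTE (pa_self j)).
rewrite tr_selmxK; first by rewrite addrC subrK.
move=> i l ip.
rewrite !mxE !ord1 eqxx andbT; case: eqVneq => [->|ij]; first by rewrite L1 subrr.
by rewrite L0// subr0.
Qed.

Lemma precisionE i j : precision D L i j = \sum_k L i k * L j k / D k k.
Proof.
rewrite /precision invmx_Theta_diag mxE; apply: eq_bigr => k _.
by rewrite mul_mx_diag !mxE mulrAC.
Qed.

(** This is where the columns decouple. *)
Lemma trace_precision U : \tr (precision D L *m U) =
  \sum_j (D j j)^-1 * ((col j L)^T *m U *m col j L) 0 0.
Proof.
rewrite /precision invmx_Theta_diag -!mulmxA mxtrace_mulC -!mulmxA.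
apply: eq_bigr => j _; rewrite mul_diag_mx mxE [X in X * _]mxE.
congr (_ * _); rewrite -mulmxA mxE [RHS]mxE; apply: eq_bigr => k _.
rewrite !mxE; congr (_ * _); apply: eq_bigr => l _.
by rewrite !mxE.
Qed.

Lemma posdef_precision : posdefmx (precision D L).
Proof.
split.
  rewrite /precision !trmx_mul trmxK invmx_Theta_diag tr_diag_mx.
  by rewrite mulmxA.
move=> v v0.
pose u := L^T *m v.
have u0 : u != 0.
  apply: contra v0 => /eqP uE.
  have uLT : L^T \in unitmx by rewrite unitmx_tr Theta_unitL.
  by rewrite -(mulKmx uLT v) -/u uE mulmx0.
rewrite /precision !mulmxA (_ : v^T *m L = u^T); last by rewrite trmx_mul trmxK.
rewrite -(mulmxA _ L^T) -/u invmx_Theta_diag mxE.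
have nz : forall i, true -> 0 <= u i 0 ^+ 2 / D i i.
  by move=> i _; rewrite mulr_ge0 ?sqr_ge0// invr_ge0 ltW.
have -> : \sum_j (u^T *m diag_mx (\row_i (D i i)^-1)) 0 j * u j 0 =
    \sum_j u j 0 ^+ 2 / D j j.
  by apply: eq_bigr => j _; rewrite mul_mx_diag !mxE expr2 mulrAC.
rewrite lt_neqAle sumr_ge0// andbT eq_sym psumr_neq0//.
have [i ui] : exists i, u i 0 != 0.
  apply/existsP; apply: contraNT u0 => /existsPn u00.
  by apply/eqP/matrixP => i j; rewrite ord1 [RHS]mxE; apply/eqP/negbNE/u00.
apply/hasP; exists i; first exact: mem_index_enum.
by rewrite /= mulr_gt0 ?invr_gt0// exprn_even_gt0.
Qed.

(** Descending induction on [j]: in the entry [(i, j)] of [invmx L *m L] every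
    term other than the one sought vanishes, by triangularity of [L] or by the
    induction hypothesis. *)
Lemma invmx_lower i j : (i < j)%N -> invmx L i j = 0.
Proof.
have [n] := ubnP (p - j); elim: n => // n IH in j * => jn ij.
have /matrixP/(_ i j) := mulVmx Theta_unitL.
rewrite !mxE (bigD1 j)//= L1 mulr1 (negbTE (_ : i != j)).
  rewrite big1 ?addr0// => k kj.
  have [jk|kj'] := ltnP j k; last first.
    by rewrite tL ?mulr0// ltn_neqAle kj.
  rewrite IH ?mul0r//; last exact: ltn_trans jk.
  apply: (@leq_trans (p - j)); last exact: jn.
  exact: ltn_sub2l (ltn_ord j) jk.
by apply: contraTN ij => /eqP ->; rewrite ltnn.
Qed.

Lemma invmx_lower_diag j : invmx L j j = 1.
Proof.
have /matrixP/(_ j j) := mulVmx Theta_unitL.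
rewrite !mxE (bigD1 j)//= L1 mulr1 eqxx big1 ?addr0// => k kj.
have [jk|kj'] := ltnP j k; first by rewrite invmx_lower// mul0r.
by rewrite tL ?mulr0// ltn_neqAle kj.
Qed.

Lemma posdef_invmx (A : 'M[R]_p) : posdefmx A -> posdefmx (invmx A).
Proof.
move=> pA; have uA := posdef_unit pA; have [As Ap] := pA.
split; first by rewrite trmx_inv As.
move=> v v0; have := Ap (invmx A *m v).
rewrite trmx_mul trmx_inv As !mulmxA mulmxKV//; apply.
apply: contra v0 => /eqP uE.
by rewrite -(mulKVmx uA v) uE mulmx0.
Qed.

(** In the linear model with precision [L D^-1 L^T] the residual of variable [j]
    given its parents has coefficients the j-th column of [L] and variance
    [D j j].  Formally, the covariance maps that column to [D j j] times the j-th
    column of the inverse transpose of [L], which vanishes at the parents since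
    they come after [j]. *)
Lemma condvar_inv_precision j :
  condvar (invmx (precision D L)) j (pa E j) = D j j.
Proof.
have pO := posdef_precision; have uO := posdef_unit pO.
set Sg := invmx _.
have SgL : Sg *m L = (invmx L)^T *m D.
  rewrite -[RHS](mulKmx uO); congr (_ *m _).
  rewrite /precision -!mulmxA (mulmxA L^T) -trmx_mul mulVmx ?Theta_unitL//.
  by rewrite trmx1 mul1mx mulVmx ?mulmx1// Theta_unitD.
have [/is_diag_mxP dD _ _] := th.
have SgLE i : (Sg *m col j L) i 0 = invmx L j i * D j j.
  rewrite colE mulmxA SgL -colE !mxE (bigD1 j)//= big1 ?addr0.
    by rewrite mxE.
  by move=> k kj; rewrite dD ?mulr0.
have -> : condvar Sg j (pa E j) = ((delta_mx 0 j : 'rV[R]_p) *m Sg *m col j L) 0 0.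
  rewrite condvar_regvec; congr ((_ *m _) 0 0).
  apply: regvec_unique.
  - exact/psubmx_unit/posdef_invmx.
  - move=> k kp; rewrite mxE; case: eqVneq => [->|kj]; first by rewrite L1.
    by rewrite L0.
  - exact: pa_self.
  - apply/matrixP => k l; rewrite -mulmxA selmx_mul mxE ord1 SgLE mxE.
    by rewrite invmx_lower ?mul0r// pa_lt// enum_valP.
by rewrite -mulmxA -rowE mxE SgLE invmx_lower_diag mul1r.
Qed.

End Theta.
End precision_matrices.

(** * Sums of squares and products over the edges *)

Section sum_of_squares.
Context {R : realType} {p : nat}.

(** The triangular factorisation of the submatrix, transported from positions in
    the enumeration of [S] to elements of [S].  The rank [r] records that the
    i-th new coordinate involves [i] and indices of smaller rank only. *)
Lemma quadratic_sum_squares (A : 'M[R]_p) (S : {set 'I_p}) : posdefmx A ->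
  exists (W : 'I_p -> 'I_p -> R) (d : 'I_p -> R) (r : 'I_p -> nat),
  [/\ forall i, i \in S -> W i i = 1,
      forall i l, i \in S -> l \in S -> l != i -> (r i <= r l)%N -> W i l = 0,
      forall i, i \in S -> 0 < d i,
      \det (psubmx A S) = \prod_(i in S) d i &
      forall v : 'I_p -> R,
        let V : 'cV_#|S| := \col_k v (enum_val k) in
        (V^T *m psubmx A S *m V) 0 0 =
        \sum_(i in S) d i * (\sum_(l in S) W i l * v l) ^+ 2].
Proof.
move=> pA; have [W [d [W1 W0 d0 AE]]] := posdef_factor (posdef_psubmx S pA).
(* The factor is upper triangular, so later positions come first. *)
pose r i := (#|S| - index i (enum S))%N.
pose rk i : option 'I_#|S| := [pick k | enum_val k == i].
have rkE (k : 'I_#|S|) : rk (enum_val k) = Some k.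
  rewrite /rk; case: pickP => [l /eqP/enum_val_inj ->//|/(_ k)].
  by rewrite eqxx.
pose W' i l := if rk i is Some k then if rk l is Some m then W k m else 0 else 0.
pose d' i := if rk i is Some k then d 0 k else 0.
have rE (k : 'I_#|S|) : r (enum_val k) = (#|S| - k)%N.
  have kS : (k < size (enum S))%N by rewrite -cardE.
  have [x0 _] : exists x0 : 'I_p, true by exists (enum_val k).
  by rewrite /r (enum_val_nth x0) index_uniq// enum_uniq.
have onS (P : 'I_p -> Prop) : (forall k : 'I_#|S|, P (enum_val k)) ->
    forall i, i \in S -> P i.
  by move=> h i iS; rewrite -(enum_rankK_in iS iS).
exists W', d', r; split.
- by apply: (onS) => k; rewrite /W' !rkE.
- move=> i l iS lS; move: l lS i iS; apply: (onS) => l; apply: (onS) => k.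
  rewrite /W' !rkE !rE (inj_eq enum_val_inj) => lk kl; apply: W0.
  rewrite ltn_neqAle (inj_eq val_inj) lk leqNgt; apply/negP => kl'.
  by move: kl; rewrite leqNgt ltn_sub2l// (leq_trans kl')// ltnW.
- by apply: (onS) => k; rewrite /d' rkE.
- rewrite (posdef_det W1 W0 AE) (big_enum_val (fun i => d' i)) /=.
  by apply: eq_bigr => k _; rewrite /d' rkE.
- move=> v V; rewrite AE !mulmxA -(trmxK (V^T *m W^T)) trmx_mul !trmxK -mulmxA.
  set Y := W *m V.
  rewrite mxE (big_enum_val (fun i => d' i * _)) /=; apply: eq_bigr => k _.
  rewrite mul_mx_diag !mxE /d' rkE mulrAC -expr2 mulrC; congr (_ * _ ^+ 2).
  rewrite (big_enum_val (fun l => W' _ l * v l)) /=; apply: eq_bigr => l _.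
  by rewrite !mxE /W' !rkE.
Qed.

End sum_of_squares.

Section products.
Context {R : realType} {p : nat}.
Variable E : {set 'I_p * 'I_p}.
Hypothesis hE : parent_dag E.

(** The coordinates of the chart, grouped by column. *)
Lemma prod_dag (f : 'I_p * 'I_p -> R) :
  \prod_(k < #|E|) f (enum_val k) =
  \prod_j (f (j, j) * \prod_(i in pa E j) f (i, j)).
Proof.
rewrite -(big_enum_val f) /=.
rewrite (eq_bigr (fun e => f (e.1, e.2))); last by case.
rewrite (eq_bigl (fun e => xpredT e.1 && ((e.1, e.2) \in E))); last by case.
rewrite -(pair_big_dep xpredT (fun i j => (i, j) \in E) (fun i j => f (i, j))) /=.
rewrite (exchange_big_dep xpredT) //=; apply: eq_bigr => j _.
rewrite (bigD1 j) ?hE.1//=; congr (_ * _); apply: eq_bigl => i.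
by rewrite inE andbC.
Qed.

Lemma entry_upd (x : @RE R p E) (k : 'I_#|E|) t e :
  entry (upd x k t) e = if e == enum_val k then t else entry x e.
Proof.
have [eE|eE] := boolP (e \in E); last first.
  rewrite !entry_out//; case: eqP => // ek.
  by rewrite ek enum_valP in eE.
by rewrite -(enum_rankK_in eE eE) !entry_tnth tnth_upd (inj_eq enum_val_inj).
Qed.

Lemma eq_entry (x y : @RE R p E) e :
  (forall k, enum_val k = e -> tnth x k = tnth y k) -> entry x e = entry y e.
Proof.
have [eE|eE] := boolP (e \in E); last by rewrite !entry_out.
by rewrite -(enum_rankK_in eE eE) !entry_tnth; apply.
Qed.

Lemma measurable_entry e :
  measurable_fun setT (fun x : @RE R p E => entry x e : measurableTypeR R).
Proof.
have [eE|eE] := boolP (e \in E); last first.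
  by rewrite (_ : (fun x => _) = cst 0)//; apply/funext => x; rewrite entry_out.
rewrite -(enum_rankK_in eE eE).
by under eq_fun do rewrite entry_tnth; exact: measurable_coord.
Qed.

End products.

(** * The normalising constant *)

Section column_identities.
Context {R : realType} {p : nat}.
Implicit Types (S : {set 'I_p}).

Lemma prod_sqrt S (d : 'I_p -> R) : (forall i, i \in S -> 0 < d i) ->
  \prod_(i in S) Num.sqrt (d i) = Num.sqrt (\prod_(i in S) d i).
Proof.
move=> d0.
suff [_ ->//] : 0 <= \prod_(i in S) d i /\
    \prod_(i in S) Num.sqrt (d i) = Num.sqrt (\prod_(i in S) d i).
elim/big_rec2 : _ => [|i y x iS [x0 ->]]; first by rewrite sqrtr1.
have di := ltW (d0 i iS).
by rewrite mulr_ge0// sqrtrM.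
Qed.

(** The contribution of one column to the density.  The power of [D] lost between
    the two sides is absorbed by the Jacobian of the scaling of its
    off-diagonal coordinates, and the determinant by the same Jacobian. *)
Lemma column_density_split S (D c al : R) (d s : 'I_p -> R) : 0 < D ->
  (forall i, i \in S -> 0 < d i) ->
  let a := (al - #|S|%:R) / 2 - 1 in
  D `^ (- (al / 2)) *
    expR (- (1 / 2) * (D^-1 * (c + \sum_(i in S) d i * s i ^+ 2))) =
  (\prod_(i in S) d i) `^ (- (1 / 2)) *
    ((D `^ (- (a + 1)) * expR (- (1 / 2) * (D^-1 * c)) *
      \prod_(i in S) expR (- (1 / 2) * (Num.sqrt (d i / D) * s i) ^+ 2)) *
     \prod_(i in S) Num.sqrt (d i / D)).
Proof.
move=> D0 d0 a.
have -> : expR (- (1 / 2) * (D^-1 * (c + \sum_(i in S) d i * s i ^+ 2))) =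
    expR (- (1 / 2) * (D^-1 * c)) *
    \prod_(i in S) expR (- (1 / 2) * (Num.sqrt (d i / D) * s i) ^+ 2).
  rewrite -expR_sum -expRD; congr expR; rewrite !mulrDr; congr (_ + _).
  rewrite !mulr_sumr; apply: eq_bigr => i iS.
  rewrite exprMn sqr_sqrtr; last by rewrite ltW// divr_gt0// d0.
  by ring.
have -> : \prod_(i in S) Num.sqrt (d i / D) =
    Num.sqrt (\prod_(i in S) d i) * (D `^ (- (1 / 2))) ^+ #|S|.
  rewrite -prod_sqrt// -prodr_const -big_split/=; apply: eq_bigr => i iS.
  rewrite sqrtrM ?ltW ?d0// sqrtrV ?ltW// powRN div1r powR12_sqrt//.
  exact: ltW.
have P0 : 0 < \prod_(i in S) d i by rewrite prodr_gt0.
have sP : Num.sqrt (\prod_(i in S) d i) != 0 by rewrite gt_eqF// sqrtr_gt0.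
have -> : (\prod_(i in S) d i) `^ (- (1 / 2)) = (Num.sqrt (\prod_(i in S) d i))^-1.
  by rewrite powRN div1r powR12_sqrt ?ltW.
have -> : D `^ (- (al / 2)) = D `^ (- (a + 1)) * (D `^ (- (1 / 2))) ^+ #|S|.
  rewrite -powR_mulrn ?powR_ge0// -powRrM -powRD; last by rewrite (gt_eqF D0) implybT.
  by congr (_ `^ _); rewrite /a; field.
by rewrite ?div1r; field.
Qed.

Lemma column_constant S (dt c al G : R) : 0 < c ->
  let a := (al - #|S|%:R) / 2 - 1 in
  dt `^ (- (1 / 2)) * ((c / 2) `^ (- a) * G * \prod_(i in S) (2 * pi) `^ (1 / 2)) =
  2 `^ (al / 2 - 1) * pi `^ (#|S|%:R / 2) * G * dt `^ (- (1 / 2)) * c `^ (- a).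
Proof.
move=> c0 a.
rewrite prodr_const -powR_mulrn ?powR_ge0// -powRrM [(2 * pi) `^ _]powRM ?pi_ge0//.
have -> : (c / 2) `^ (- a) = c `^ (- a) * 2 `^ a.
  rewrite powRM ?ltW// -[X in _ * X `^ _]powR_inv1// -powRrM.
  by rewrite mulN1r opprK.
have -> : 2 `^ (al / 2 - 1) = 2 `^ a * 2 `^ (1 / 2 * #|S|%:R) :> R.
  rewrite -powRD; last by rewrite pnatr_eq0 implybT.
  by congr (_ `^ _); rewrite /a; field.
have -> : pi `^ (#|S|%:R / 2) = pi `^ (1 / 2 * #|S|%:R) :> R.
  by congr (_ `^ _); field.
by ring.
Qed.

End column_identities.

Section normalisation.
Context {R : realType} {p : nat}.
Variable E : {set 'I_p * 'I_p}.
Hypothesis hE : parent_dag E.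
Implicit Types (U : 'M[R]_p) (alpha : 'I_p -> R) (x : @RE R p E).

(** Boolean form of membership of the chart in [Theta], to be used as a factor of
    integrands. *)
Definition in_chart x : bool := [forall j, 0 < entry x (j, j)].

Lemma in_chartP x : reflect (Theta E (coordD x, coordL x)) (in_chart x).
Proof. by apply: (iffP forallP) => h; apply/(Theta_coord hE). Qed.

(** The precision matrix as an explicit rational function of the coordinates,
    which makes its measurability on the whole chart immediate. *)
Definition chart_precision x : 'M[R]_p :=
  \matrix_(i, j) \sum_k coordL x i k * coordL x j k / entry x (k, k).

Lemma chart_precisionE x : in_chart x ->
  chart_precision x = precision (coordD x) (coordL x).
Proof.
move/in_chartP => th; apply/matrixP => i j; rewrite (precisionE th) mxE.
by apply: eq_bigr => k _; rewrite [coordD _ _ _]mxE eqxx mulr1n.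
Qed.

Definition theta_kernel U alpha x : R :=
  (in_chart x)%:R * (expR (- (1 / 2) * \tr (chart_precision x *m U)) *
    \prod_j entry x (j, j) `^ (- (alpha j / 2))).

Lemma theta_kernel_ge0 U alpha x : 0 <= theta_kernel U alpha x.
Proof. by rewrite !mulr_ge0 ?expR_ge0 ?prodr_ge0// => *; exact: powR_ge0. Qed.

Lemma measurable_in_chart :
  measurable_fun setT (fun x => (in_chart x)%:R : measurableTypeR R).
Proof.
rewrite (_ : (fun x => _) = (fun x => \prod_j (0 < entry x (j, j))%R%:R : R)).
  by apply: measurable_prod => j _; exact: (measurable_gt0 (measurable_entry (j, j))).
apply/funext => x; rewrite /in_chart; case: (boolP [forall j, _]) => [/forallP h|].
  by rewrite big1// => j _; rewrite h.
rewrite negb_forall => /existsP[j /negbTE h].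
by rewrite (bigD1 j)//= h mul0r.
Qed.

Lemma measurable_chart_precision i j :
  measurable_fun setT (fun x => chart_precision x i j : measurableTypeR R).
Proof.
under eq_fun do rewrite mxE.
apply: measurable_sum => k; apply: measurable_funM.
  by under eq_fun do rewrite !mxE; apply: measurable_funM;
    case: eqP => // _; exact: measurable_entry.
exact: (measurableT_comp measurable_invr (measurable_entry _)).
Qed.

Lemma measurable_trace_chart U :
  measurable_fun setT (fun x => \tr (chart_precision x *m U) : measurableTypeR R).
Proof.
apply: measurable_sum => i; under eq_fun do rewrite mxE.
apply: measurable_sum => j; apply: measurable_funM => //.
exact: measurable_chart_precision.
Qed.

Lemma measurable_theta_kernel U alpha : measurable_fun setT (theta_kernel U alpha).
Proof.
apply: measurable_funM; first exact: measurable_in_chart.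
apply: measurable_funM.
  apply: measurableT_comp => //; apply: measurable_funM => //.
  exact: measurable_trace_chart.
apply: measurable_prod => j _.
exact: (measurableT_comp (measurable_powR _) (measurable_entry _)).
Qed.

(** The new coordinates of column [j] are triangular combinations of the free
    coordinates, recentred at the opposite of the regression coefficients, which
    are the entries of the residual vector. *)
Lemma column_quadratic U j (W : 'I_p -> 'I_p -> R) (d : 'I_p -> R) x :
  posdefmx U ->
  (forall v : 'I_p -> R,
    let V : 'cV_#|pa E j| := \col_k v (enum_val k) in
    (V^T *m psubmx U (pa E j) *m V) 0 0 =
    \sum_(i in pa E j) d i * (\sum_(l in pa E j) W i l * v l) ^+ 2) ->
  in_chart x ->
  ((col j (coordL x))^T *m U *m col j (coordL x)) 0 0 =
  condvar U j (pa E j) + \sum_(i in pa E j) d i *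
    (\sum_(l in pa E j) W i l * (entry x (l, j) - regvec U j (pa E j) l 0)) ^+ 2.
Proof.
move=> pU HW /in_chartP th.
have jp := pa_self hE j.
rewrite {1 2}(col_Theta hE th j) quadratic_complete// -HW; congr (_ + _).
suff <- : selmx (pa E j) *m col j (coordL x) +
    invmx (psubmx U (pa E j)) *m subcol U (pa E j) j =
    \col_k (entry x (enum_val k, j) - regvec U j (pa E j) (enum_val k) 0) by [].
apply/matrixP => k l; rewrite ord1 mxE [RHS]mxE selmx_mul [X in X + _]mxE.
have pj (m : 'I_#|pa E j|) : (enum_val m == j) = false.
  by apply/eqP => mj; have := enum_valP m; rewrite mj (negbTE jp).
congr (_ + _); first by rewrite !mxE pj.
have /matrixP/(_ k 0) : selmx (pa E j) *m regvec U j (pa E j) =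
    - (invmx (psubmx U (pa E j)) *m subcol U (pa E j) j).
  rewrite /regvec mulmxBr !mulmxA selmxK mul1mx -colE.
  apply/matrixP => m n; rewrite mxE [col j _ _ _]mxE [X in X + _]mxE.
  by rewrite pj add0r.
by rewrite selmx_mul mxE => ->; rewrite [X in _ = - X]mxE opprK.
Qed.

(** Column by column, the off-diagonal coordinates are replaced by the triangular
    combinations that diagonalise the quadratic form, scaled by
    [sqrt (d / D j j)], while the diagonal coordinates are kept.  In the new
    coordinates the integrand is a product of functions of a single
    coordinate. *)
Lemma theta_kernel_integral U alpha : posdefmx U ->
  (forall j, Gamma (a_of E alpha j) != 0) ->
  (\int[lebesgue_Rn R #|E|]_x (theta_kernel U alpha x)%:E = (zD E U alpha)%:E)%E.
Proof.
move=> pU G0.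
have [W /choice[d /choice[r H]]] :=
  choice (fun j => quadratic_sum_squares (pa E j) pU).
pose c j := condvar U j (pa E j).
pose w j l := regvec U j (pa E j) l 0.
pose a j := a_of E alpha j.
have c0 j : 0 < c j by apply: condvar_gt0 => //; exact: pa_self.
(* The scaling has to be invertible also where the j-th diagonal coordinate is
   not positive; the integrand vanishes there, so any positive value will do. *)
pose Dp j x : R := if 0 < entry x (j, j) then entry x (j, j) else 1.
have Dp0 j x : 0 < Dp j x by rewrite /Dp; case: ifP.
pose sc (e : 'I_p * 'I_p) x := Num.sqrt (d e.2 e.1 / Dp e.2 x).
pose lin (e : 'I_p * 'I_p) x :=
  \sum_(l in pa E e.2) W e.2 e.1 l * (entry x (l, e.2) - w e.2 l).
pose ue (e : 'I_p * 'I_p) x := if e.1 == e.2 then entry x e else sc e x * lin e x.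
pose rhoe (e : 'I_p * 'I_p) x := if e.1 == e.2 then 1 else sc e x.
(* The diagonal coordinate of a column comes before its off-diagonal ones, which
   are ordered by the rank of the factorisation. *)
pose re (e : 'I_p * 'I_p) := if e.1 == e.2 then 0%N else (r e.2 e.1).+1.
pose ge (e : 'I_p * 'I_p) (t : measurableTypeR R) : R :=
  if e.1 == e.2 then (0 < t)%R%:R *
    (t `^ (- (a e.2 + 1)) * expR (- (1 / 2) * (t^-1 * c e.2)))
  else expR (- (1 / 2) * t ^+ 2).
pose Ie (e : 'I_p * 'I_p) : R :=
  if e.1 == e.2 then (c e.2 / 2) `^ (- a e.2) * Gamma (a e.2)
  else (2 * pi) `^ (1 / 2).
have offdiag (k : 'I_#|E|) : (enum_val k).1 != (enum_val k).2 ->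
    (enum_val k).1 \in pa E (enum_val k).2.
  move=> ne; have := enum_valP k; case: (enum_val k) ne => i j /= ne.
  by rewrite (mem_dag hE) (negbTE ne).
have sc0 (k : 'I_#|E|) x : (enum_val k).1 != (enum_val k).2 ->
    0 < sc (enum_val k) x.
  move=> /offdiag kp; rewrite sqrtr_gt0 divr_gt0//.
  by have [_ _ + _ _] := H (enum_val k).2; apply.
have msc e : measurable_fun setT (fun x => sc e x : measurableTypeR R).
  have msqrt : measurable_fun setT (@Num.sqrt R : measurableTypeR R -> measurableTypeR R).
    by apply: continuous_measurable_fun; exact: sqrt_continuous.
  apply: (measurableT_comp msqrt); apply: measurable_funM => //.
  apply: (measurableT_comp measurable_invr).
  apply: measurable_fun_ifT => //; last exact: measurable_entry.
  exact: measurable_fun_ltr (measurable_cst _) (measurable_entry _).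
have mlin e : measurable_fun setT (fun x => lin e x : measurableTypeR R).
  under eq_fun do rewrite /lin big_mkcond.
  apply: measurable_sum => l; case: (l \in pa E e.2) => //.
  apply: measurable_funM => //; apply: measurable_funB => //.
  exact: measurable_entry.
have mue e : measurable_fun setT (fun x => ue e x : measurableTypeR R).
  rewrite /ue; case: eqP => _; first exact: measurable_entry.
  exact: measurable_funM (msc e) (mlin e).
have mrhoe e : measurable_fun setT (fun x => rhoe e x : measurableTypeR R).
  by rewrite /rhoe; case: eqP => _ //; exact: msc.
have mge e : measurable_fun setT (ge e).
  rewrite /ge; case: eqP => _.
    apply: measurable_funM; first exact: (measurable_gt0 (f := id)).
    apply: measurable_funM; first exact: measurable_powR.
    apply: measurableT_comp => //; apply: measurable_funM => //.
    by apply: measurable_funM => //; exact: measurable_invr.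
  by apply: measurableT_comp => //; apply: measurable_funM.
have ge0 e t : 0 <= ge e t.
  by rewrite /ge; case: eqP; rewrite ?expR_ge0// !mulr_ge0 ?powR_ge0 ?expR_ge0.
have dep_sc (k : 'I_#|E|) : (enum_val k).1 != (enum_val k).2 ->
    depends_upto (fun k => re (enum_val k)) k (sc (enum_val k)).
  move=> ne x y xy; rewrite /sc /Dp.
  suff -> : entry x ((enum_val k).2, (enum_val k).2) =
            entry y ((enum_val k).2, (enum_val k).2) by [].
  apply: eq_entry => m mE; apply: xy; rewrite mE /re/= eqxx (negbTE ne).
  by rewrite orbT.
have dep_lin (k : 'I_#|E|) : (enum_val k).1 != (enum_val k).2 ->
    depends_upto (fun k => re (enum_val k)) k (lin (enum_val k)).
  move=> ne x y xy; rewrite /lin; apply: eq_bigr => l lp.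
  have ip := offdiag _ ne; have [_ Wtri _ _ _] := H (enum_val k).2.
  have [li|li] := boolP ((l != (enum_val k).1) &&
                         (r (enum_val k).2 (enum_val k).1 <= r (enum_val k).2 l)%N).
    by move: li => /andP[l1 l2]; rewrite Wtri// !mul0r.
  congr (_ * (_ - _)); apply: eq_entry => m mE; apply: xy.
  move: li; rewrite negb_and negbK -ltnNge => /orP[/eqP lk|rl].
    by apply/orP; left; rewrite -(inj_eq enum_val_inj) mE lk -surjective_pairing.
  apply/orP; right; rewrite /re mE/= (negbTE ne) ifF//.
  by apply/eqP => lk; have := pa_self hE l; rewrite {2}lk lp.
have dep_u (k : 'I_#|E|) : depends_upto (fun k => re (enum_val k)) k (ue (enum_val k)).
  move=> x y xy; rewrite /ue; case: eqVneq => ne; last first.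
    by rewrite (dep_sc _ ne _ _ xy) (dep_lin _ ne _ _ xy).
  by rewrite !entry_tnth xy// eqxx.
have dep_rho (k : 'I_#|E|) : depends_upto (fun k => re (enum_val k)) k (rhoe (enum_val k)).
  move=> x y xy; rewrite /rhoe; case: eqVneq => ne //.
  exact: dep_sc ne _ _ xy.
have rho0 e x : 0 <= rhoe e x by rewrite /rhoe; case: eqP => // _; rewrite sqrtr_ge0.
have slice (k : 'I_#|E|) x (f : measurableTypeR R -> R) : measurable_fun setT f ->
    (forall t, 0 <= f t) ->
    (\int[lebesgue_measure]_t
        (f (ue (enum_val k) (upd x k t)) * rhoe (enum_val k) (upd x k t))%:E =
     \int[lebesgue_measure]_t (f t * 1)%:E)%E.
  move=> mf f0; rewrite /ue /rhoe; case: eqVneq => ne.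
    by apply: eq_integral => t _; rewrite entry_upd eqxx.
  have ip := offdiag _ ne; have [W1 _ _ _ _] := H (enum_val k).2.
  have scE t : sc (enum_val k) (upd x k t) = sc (enum_val k) x.
    rewrite /sc /Dp entry_upd (_ : (_ == _) = false)//.
    by apply/eqP => kk; move: ne; rewrite -kk eqxx.
  pose b := - w (enum_val k).2 (enum_val k).1 +
    \sum_(l in pa E (enum_val k).2 | l != (enum_val k).1)
       W (enum_val k).2 (enum_val k).1 l *
         (entry x (l, (enum_val k).2) - w (enum_val k).2 l).
  have linE t : lin (enum_val k) (upd x k t) = t + b.
    rewrite /lin (bigD1 (enum_val k).1)//= W1// mul1r entry_upd.
    rewrite -surjective_pairing eqxx /b addrA; congr (_ + _).
    apply: eq_bigr => l /andP[_ lk]; rewrite entry_upd (_ : (_ == _) = false)//.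
    by apply/eqP => kk; move: lk; rewrite -kk eqxx.
  under eq_integral do rewrite scE linE mulrDr.
  rewrite ge0_integral_affine//; last exact: sc0.
  by apply: eq_integral => t _; rewrite mulr1.
pose F (x : @RE R p E) := \prod_(k < #|E|) ge (enum_val k) (tnth x k).
have mF : measurable_fun setT F.
  apply: measurable_prod => k _.
  exact: (measurableT_comp (mge _) (measurable_coord k)).
have F0 x : 0 <= F x by rewrite prodr_ge0.
have change := triangular_change_of_variables dep_u dep_rho
  (fun k => mue (enum_val k)) (fun k => mrhoe (enum_val k))
  (sigma := fun _ _ => 1) (fun _ => measurable_cst _)
  (fun k => rho0 (enum_val k)) (fun _ _ => ler01) slice mF F0.
have intF : (\int[lebesgue_Rn R #|E|]_x (F x)%:E =
    (\prod_j (Ie (j, j) * \prod_(i in pa E j) (2 * pi) `^ (1 / 2)))%:E)%E.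
  rewrite /F (integral_Rn_prod (g := fun k => ge (enum_val k)))//.
  have ie (k : 'I_#|E|) : (\int[lebesgue_measure]_t (ge (enum_val k) t)%:E =
      (Ie (enum_val k))%:E)%E.
    rewrite /ge /Ie; case: eqVneq => ne; last exact: integral_half_gauss.
    exact: integral_inverse_gamma.
  rewrite (eq_bigr _ (fun k _ => ie k)).
  rewrite prodEFin (prod_dag hE Ie); congr (_%:E); apply: eq_bigr => j _.
  congr (_ * _); apply: eq_bigr => i ip; rewrite /Ie/= ifF//.
  by apply/eqP => ij; have := pa_self hE j; rewrite -{1}ij ip.
(* what remains of the Jacobian once the powers of D are taken out *)
pose C := \prod_j (\det (psubmx U (pa E j))) `^ (- (1 / 2)).
have kernelE x : theta_kernel U alpha x =
    C * (F [tuple ue (enum_val k) x | k < #|E|] * \prod_(k < #|E|) rhoe (enum_val k) x).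
  have -> : F [tuple ue (enum_val k) x | k < #|E|] =
      \prod_(k < #|E|) ge (enum_val k) (ue (enum_val k) x).
    by apply: eq_bigr => k _; rewrite tnth_mktuple.
  rewrite (prod_dag hE (fun e => ge e (ue e x))) (prod_dag hE (fun e => rhoe e x)).
  have [inx|ninx] := boolP (in_chart x); last first.
    rewrite /theta_kernel (negbTE ninx) mul0r.
    move: ninx; rewrite negb_forall => /existsP[j /negbTE xj].
    by rewrite [in RHS](bigD1 j)//= {1}/ge {1}/ue/= eqxx xj !mul0r mulr0.
  have x0 j : 0 < entry x (j, j) by exact: (forallP inx).
  have offd i j : i \in pa E j -> (i == j) = false.
    by move=> ip; apply/eqP => ij; have := pa_self hE j; rewrite -{1}ij ip.
  rewrite /theta_kernel inx [LHS]mul1r chart_precisionE//.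
  rewrite (trace_precision (in_chartP _ inx)) mulr_sumr expR_sum.
  rewrite /C -!big_split/=; apply: eq_bigr => j _.
  have [_ _ dj detj quadj] := H j.
  rewrite (column_quadratic pU quadj inx) [coordD _ _ _]mxE eqxx mulr1n mulrC.
  rewrite (column_density_split _ _ _ (x0 j) dj) -detj; congr (_ * _).
  rewrite /rhoe/= eqxx [X in _ = _ * X]mul1r /ge /ue/= eqxx x0.
  rewrite [X in _ = X * _ * _]mul1r.
  have DpE : Dp j x = entry x (j, j) by rewrite /Dp x0.
  congr (_ * _ * _); apply: eq_bigr => i ip; rewrite offd// /sc DpE//.
under eq_integral do rewrite kernelE EFinM.
rewrite ge0_integralZl//; last 3 first.
- apply/measurable_EFinP; apply: measurable_funM.
    apply: (measurableT_comp mF); apply: measurable_to_Rn => k.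
    by under eq_fun do rewrite tnth_mktuple; exact: mue.
  by apply: measurable_prod => k _; exact: mrhoe.
- by move=> x _; rewrite lee_fin mulr_ge0// prodr_ge0.
- by rewrite lee_fin prodr_ge0// => j _; exact: powR_ge0.
rewrite change; under eq_integral do rewrite big1 ?mulr1//.
rewrite intF -EFinM /C -big_split/=; congr (_%:E); apply: eq_bigr => j _.
rewrite /Ie/= eqxx; exact: column_constant.
Qed.

End normalisation.

(** * Laplace transform *)

Section laws.
Context {R : realType} d (T : measurableType d) (P : probability T R).

Lemma has_density_integral n (X : T -> Rn R n) (S : set (Rn R n)) (f : Rn R n -> R)
    (g : Rn R n -> R) :
  has_density P X S f -> measurable_fun setT g -> (forall x, 0 <= g x) ->
  (\int[P]_t (g (X t))%:E = \int[lebesgue_Rn R n]_x (g x * (f \_ S) x)%:E)%E.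
Proof.
move=> [mX mS mf f0 law] mg g0.
have mfS : measurable_fun setT (f \_ S : Rn R n -> measurableTypeR R).
  exact/(measurable_restrictT _ mS).
have fS0 y : 0 <= (f \_ S) y by rewrite patchE; case: ifPn => // /set_mem /f0.
have lawS A : measurable A ->
    P (setT `&` X @^-1` A) = (\int[lebesgue_Rn R n]_(y in A) ((f \_ S) y)%:E)%E.
  move=> mA; rewrite setTI law// integral_mkcondl; apply: eq_integral => x _.
  by rewrite !patchE; case: ifP.
exact: (ge0_integral_transfer measurableT mX mfS fS0 lawS mg g0).
Qed.

End laws.

Section dag_wishart.
Context {R : realType} {p : nat}.
Variable E : {set 'I_p * 'I_p}.
Hypothesis hE : parent_dag E.
Variables (U : 'M[R]_p) (pU : posdefmx U) (alpha : 'I_p -> R).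
Context d (T : measurableType d) (P : probability T R).
Variables (D L : T -> 'M[R]_p) (hDL : DAG_Wishart E U alpha P D L).

Let X t := theta_coord E (D t) (L t).
Let th t : Theta E (D t, L t) := hDL.1 t.

Lemma in_chart_law t : in_chart (X t).
Proof. by apply/(in_chartP hE); have [-> ->] := theta_coordK hE (th t). Qed.

Lemma chart_precision_law t : chart_precision (X t) = precision (D t) (L t).
Proof.
rewrite (chart_precisionE hE (in_chart_law t)).
by have [-> ->] := theta_coordK hE (th t).
Qed.

Lemma theta_density_kernel (x : @RE R p E) :
  ((fun x : @RE R p E => theta_density E U alpha (coordD x) (coordL x)) \_
     [set x : @RE R p E | Theta E (coordD x, coordL x)]) x =
  (zD E U alpha)^-1 * theta_kernel U alpha x.
Proof.
rewrite patchE; case: ifPn => [/set_mem/= h|h].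
  have hx : in_chart x by apply/(in_chartP hE).
  rewrite /theta_density /theta_kernel hx [true%:R * _]mul1r chart_precisionE//.
  rewrite -mulrA; congr (_ * (_ * _)); apply: eq_bigr => j _.
  by rewrite [coordD _ _ _]mxE eqxx mulr1n.
rewrite /theta_kernel (_ : in_chart x = false) ?mul0r ?mulr0//.
by apply/negP => /(in_chartP hE) hx; move: h; rewrite notin_setE.
Qed.

Lemma expectation_chart g : measurable_fun setT (g : @RE R p E -> R) ->
  (forall x, 0 <= g x) ->
  (\int[P]_t (g (X t))%:E =
   \int[lebesgue_Rn R #|E|]_x
      (g x * ((zD E U alpha)^-1 * theta_kernel U alpha x))%:E)%E.
Proof.
move=> mg g0; rewrite (has_density_integral hDL.2 mg g0).
by apply: eq_integral => x _; rewrite theta_density_kernel.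
Qed.

(** The density has mass one, which excludes a zero normalising factor. *)
Lemma zD_neq0 : zD E U alpha != 0.
Proof.
apply/eqP => z0.
have m1 : measurable_fun setT (cst 1 : @RE R p E -> R) by exact: measurable_cst.
have := expectation_chart m1 (fun=> ler01).
under [X in _ = X -> _]eq_integral do rewrite z0 invr0 mul0r mulr0.
rewrite integral0 => P0.
have : (\int[P]_t (cst 1%E t) = 0)%E by rewrite -[RHS]P0; apply: eq_integral.
rewrite integral_cst// mul1e [X in X = _](@probability_setT _ _ _ P) => /eqP.
by rewrite eqe oner_eq0.
Qed.

(** Convergence of the gamma integrals, from the existence of the law. *)
Lemma Gamma_neq0 j : Gamma (a_of E alpha j) != 0.
Proof.
apply: contra zD_neq0 => /eqP G0; apply/eqP.
by rewrite /zD (bigD1 j)//= G0 mulr0 !mul0r.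
Qed.

Lemma zD_ge0 : 0 <= zD E U alpha.
Proof.
apply: prodr_ge0 => j _; rewrite !mulr_ge0 ?powR_ge0//.
by apply: Rintegral_ge0 => t _; rewrite mulr_ge0 ?powR_ge0 ?expR_ge0.
Qed.

(** The exponential factor moves the kernel from [U] to [U + 2 *: K], whose total
    mass is known; both share the same powers of [D]. *)
Lemma laplace_transform (K : 'M[R]_p) : posdefmx (U + 2 *: K) ->
  ('E_P[fun t => expR (- \tr (K *m precision (D t) (L t)))]
    = (zD E (U + 2 *: K) alpha / zD E U alpha)%:E)%E.
Proof.
move=> pK; rewrite unlock.
pose g (x : @RE R p E) := expR (- \tr (chart_precision x *m K)).
have mg : measurable_fun setT g.
  apply: measurableT_comp => //; apply: measurableT_comp => //.
  exact: measurable_trace_chart.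
transitivity (\int[P]_t (g (X t))%:E)%E.
  by apply: eq_integral => t _; rewrite /g chart_precision_law mxtrace_mulC.
rewrite expectation_chart//; last by move=> x; exact: expR_ge0.
transitivity (\int[lebesgue_Rn R #|E|]_x
    ((zD E U alpha)^-1%:E * (theta_kernel (U + 2 *: K) alpha x)%:E))%E.
  apply: eq_integral => x _; rewrite -EFinM mulrCA; congr (_ * _)%:E.
  rewrite /g /theta_kernel mulrCA; congr (_ * _).
  rewrite mulrA -expRD; congr (expR _ * _).
  by rewrite mulmxDr mxtraceD -scalemxAr mxtraceZ; field.
rewrite ge0_integralZl//.
- rewrite theta_kernel_integral//; first by rewrite -EFinM mulrC.
  exact: Gamma_neq0.
- by apply/measurable_EFinP; exact: measurable_theta_kernel.
- by move=> x _; rewrite lee_fin theta_kernel_ge0.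
- by rewrite lee_fin invr_ge0 zD_ge0.
Qed.

(** Each edge is counted once in the pairing, and twice with half weight in the
    trace against the symmetric matrix [KH H]. *)
Lemma pairing_trace (H : @RE R p E) D' L' : Theta E (D', L') ->
  pairing H (psi E D' L') = \tr (KH H *m precision D' L').
Proof.
move=> th'; set Om := precision D' L'.
have Os : Om^T = Om := (posdef_precision th').1.
have entryY i j : (i, j) \in E -> entry (psi E D' L') (i, j) = Om i j.
  by move=> ijE; rewrite (entry_tupleE (g := fun e => Om e.1 e.2)).
have -> : \tr (KH H *m Om) = \sum_i \sum_j KH H i j * Om i j.
  apply: eq_bigr => i _; rewrite mxE; apply: eq_bigr => j _.
  by rewrite -[in LHS]Os [Om^T _ _]mxE.
(* For i != j at most one of (i, j) and (j, i) is in E, so that both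
   off-diagonal halves of the trace are sums of f. *)
pose f i j := if (i, j) \in E then entry H (i, j) * Om i j / 2 else 0.
have KHf i j : i != j -> KH H i j * Om i j = f i j + f j i.
  move=> ij; rewrite mxE (negbTE ij) /f; case: ifPn => ijE.
    rewrite ifF ?addr0 1?mulrAC//; apply/negP => jiE.
    have := ltn_trans (hE.2 _ _ ijE ij) (hE.2 _ _ jiE _).
    by rewrite ltnn eq_sym => /(_ ij).
  rewrite add0r; case: ifPn => jiE; last by rewrite mul0r.
  by rewrite -[in LHS]Os [Om^T _ _]mxE mulrAC.
have -> : \sum_i \sum_j KH H i j * Om i j =
    \sum_i entry H (i, i) * Om i i +
    (\sum_i \sum_(j | j != i) f i j + \sum_i \sum_(j | j != i) f j i).
  rewrite -!big_split/=; apply: eq_bigr => i _; rewrite (bigD1 i)//= mxE eqxx.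
  by rewrite -big_split/=; congr (_ + _); apply: eq_bigr => j ji; rewrite KHf// eq_sym.
have -> : \sum_i \sum_(j | j != i) f j i = \sum_i \sum_(j | j != i) f i j.
  rewrite (exchange_big_dep xpredT)//=; apply: eq_bigr => i _.
  by apply: eq_bigl => j; rewrite eq_sym.
rewrite /pairing; congr (_ + _).
  by apply: eq_bigr => i _; rewrite entryY// hE.1.
rewrite (eq_bigr (fun e => entry H (e.1, e.2) * entry (psi E D' L') (e.1, e.2))); last by case.
rewrite (eq_bigl (fun e => xpredT e.1 && (((e.1, e.2) \in E) && (e.2 < e.1)%N))); last by case.
rewrite -(pair_big_dep xpredT (fun i j => ((i, j) \in E) && (j < i)%N)
  (fun i j => entry H (i, j) * entry (psi E D' L') (i, j))) /=.
rewrite -big_split/=; apply: eq_bigr => i _.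
rewrite -big_split/= big_mkcond [RHS]big_mkcond/=; apply: eq_bigr => j _.
rewrite /f; have [ijE|ijE] := boolP ((i, j) \in E); last by rewrite addr0; case: ifP.
rewrite entryY//; case: eqVneq => [->|ij]; first by rewrite ltnn.
rewrite (hE.2 _ _ ijE) 1?eq_sym//=.
by field.
Qed.

End dag_wishart.

(** * The Laplace transform near zero *)

Section first_order_limits.
Context {R : realType}.

Lemma ln1D_le (t : R) : 0 <= t -> ln (1 + t) <= t.
Proof.
move=> t0; rewrite -[leRHS]expRK ler_ln ?posrE ?expR_gt0 ?expR_ge1Dx//.
by rewrite ltr_pwDl.
Qed.

Lemma ln1D_ge (t : R) : 0 <= t -> t / (1 + t) <= ln (1 + t).
Proof.
move=> t0; have p0 : 0 < 1 + t by rewrite ltr_pwDl.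
rewrite -[leLHS]opprK lerNl -lnV ?posrE// -[leRHS]expRK.
rewrite ler_ln ?posrE ?expR_gt0 ?invr_gt0//.
apply: le_trans (expR_ge1Dx _).
by rewrite le_eqVlt; apply/orP; left; apply/eqP; field; rewrite gt_eqF.
Qed.

Lemma cvg_invS : (fun n => n.+1%:R^-1 : R) @ \oo --> (0 : R).
Proof. exact: cvg_harmonic. Qed.

Lemma cvg_ln1D (k : R) : 0 <= k ->
  (fun n => n.+1%:R * ln (1 + n.+1%:R^-1 * k)) @ \oo --> k.
Proof.
move=> k0.
have c1 : (fun n => k / (1 + n.+1%:R^-1 * k)) @ \oo --> k.
  have c0 : (fun n => 1 + n.+1%:R^-1 * k) @ \oo --> (1 : R).
    rewrite -[X in _ --> X](_ : 1 + 0 * k = 1); last by rewrite mul0r addr0.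
    exact: (cvgD (cvg_cst _) (cvgM cvg_invS (cvg_cst k))).
  rewrite -[X in _ --> X](_ : k * 1^-1 = k); last by rewrite invr1 mulr1.
  exact: (cvgM (cvg_cst k) (cvgV (oner_neq0 _) c0)).
apply: (squeeze_cvgr _ c1 (cvg_cst k)); apply: nearW => n.
have n0 : 0 < n.+1%:R :> R by [].
have t0 : 0 <= n.+1%:R^-1 * k by rewrite mulr_ge0// invr_ge0 ltW.
have nt : n.+1%:R * (n.+1%:R^-1 * k) = k by rewrite mulrA mulfV ?gt_eqF// mul1r.
apply/andP; split.
  rewrite -[X in X / _]nt -mulrA ler_pM2l//; exact: ln1D_ge.
by rewrite -[leRHS]nt ler_pM2l//; exact: ln1D_le.
Qed.

(** Squeeze between [x <= exp x - 1 <= x * exp x]. *)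
Lemma cvg_expRB1 (x : nat -> R) (y : R) :
  (fun n => n.+1%:R * x n) @ \oo --> y ->
  (fun n => n.+1%:R * (expR (x n) - 1)) @ \oo --> y.
Proof.
move=> nx.
have x0 : x @ \oo --> (0 : R).
  rewrite (_ : x = fun n => n.+1%:R^-1 * (n.+1%:R * x n)); last first.
    by apply/funext => n; rewrite mulrA mulVf ?mul1r// pnatr_eq0.
  by rewrite -[X in _ --> X](mul0r y); exact: (cvgM cvg_invS nx).
have ex : (fun n => expR (x n)) @ \oo --> (1 : R).
  rewrite -[X in _ --> X]expR0.
  by apply: (continuous_cvg _ _ x0); exact: continuous_expR.
have c2 : (fun n => n.+1%:R * x n * expR (x n)) @ \oo --> y.
  by rewrite -[X in _ --> X]mulr1; exact: (cvgM nx ex).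
apply: (squeeze_cvgr _ nx c2); apply: nearW => n.
rewrite -mulrA !ler_pM2l ?ltr0n//; apply/andP; split.
  by rewrite lerBrDl expR_ge1Dx.
rewrite lerBlDl -[X in X <= _]mul1r -lerBlDr -mulrBl.
by rewrite -ler_pdivlMr ?expR_gt0// div1r -expRN; exact: expR_ge1Dx.
Qed.

End first_order_limits.

Section rank1_constant.
Context {R : realType} {p : nat}.
Variable E : {set 'I_p * 'I_p}.
Hypothesis hE : parent_dag E.
Variables (U : 'M[R]_p) (pU : posdefmx U) (alpha : 'I_p -> R) (v : 'cV[R]_p).

Definition quad_pa j := (v^T *m padinv U (pa E j) *m v) 0 0.
Definition quad_fa j := (v^T *m padinv U (fa E j) *m v) 0 0.

Lemma quad_faE j : quad_fa j = quad_pa j +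
  (v^T *m regvec U j (pa E j)) 0 0 ^+ 2 / condvar U j (pa E j).
Proof.
rewrite /quad_fa /fa (padinv_insert pU (pa_self hE j)) mulmxDr mulmxDl mxE.
congr (_ + _); rewrite -scalemxAr -scalemxAl mxE mulrC; congr (_ / _).
rewrite (mulmxA v^T) -(mulmxA _ (regvec _ _ _)^T) mxE big_ord1 expr2.
congr (_ * _).
by rewrite -[in LHS](trmxK v) -trmx_mul [LHS]mxE.
Qed.

Lemma quad_pa_ge0 j : 0 <= quad_pa j.
Proof. exact: padinv_quad_ge0. Qed.

Lemma quad_fa_ge0 j : 0 <= quad_fa j.
Proof.
rewrite quad_faE addr_ge0 ?quad_pa_ge0// divr_ge0 ?sqr_ge0// ltW//.
exact: (condvar_gt0 pU (pa_self hE j)).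
Qed.

(** Each conditional variance is a ratio of determinants over [fa j] and [pa j],
    and a rank one update multiplies a determinant by an affine function of [s].
    In logarithmic form the constant thus has the affine functions of both
    families with exponents opposite up to the shift 1/2, which comes from the
    determinant over [pa j] in [zD]. *)
Lemma zD_rank1 (s : R) : 0 <= s ->
  zD E (U + s *: (v *m v^T)) alpha = zD E U alpha *
    expR (\sum_j ((a_of E alpha j - 1 / 2) * ln (1 + s * quad_pa j) -
                  a_of E alpha j * ln (1 + s * quad_fa j))).
Proof.
move=> s0; rewrite expR_sum -big_split/=; apply: eq_bigr => j _.
have jp := pa_self hE j.
rewrite (det_psubmx_rank1 pU)// (condvar_rank1 pU v s0 jp).
have q0 := quad_pa_ge0 j; have f0 := quad_fa_ge0 j.
have c0 := condvar_gt0 pU jp.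
have d0 := posdef_det_gt0 (posdef_psubmx (pa E j) pU).
have qs : 0 < 1 + s * quad_pa j by rewrite ltr_pwDl// mulr_ge0.
have fs : 0 < 1 + s * quad_fa j by rewrite ltr_pwDl// mulr_ge0.
rewrite -/(quad_pa j).
have -> : condvar U j (pa E j) +
    s * (v^T *m regvec U j (pa E j)) 0 0 ^+ 2 / (1 + s * quad_pa j) =
    condvar U j (pa E j) * ((1 + s * quad_fa j) / (1 + s * quad_pa j)).
  rewrite quad_faE; field.
  by rewrite (gt_eqF c0) (gt_eqF qs).
rewrite (powRM _ (ltW d0) (ltW qs)) (powRM _ (ltW c0)); last by rewrite divr_ge0// ltW.
rewrite [(1 + s * quad_pa j) `^ _]/powR (gt_eqF qs).
rewrite [((1 + s * quad_fa j) / _) `^ _]/powR gt_eqF; last by rewrite divr_gt0.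
rewrite ln_div ?posrE// !mulrA.
set K := 2 `^ _ * _ * _; set dt := _ `^ (- (1 / 2)); set ct := _ `^ (- a_of _ _ _).
set e1 := - (1 / 2) * _; set e2 := - a_of _ _ _ * _.
have -> : (a_of E alpha j - 1 / 2) * ln (1 + s * quad_pa j) -
    a_of E alpha j * ln (1 + s * quad_fa j) = e1 + e2.
  by rewrite /e1 /e2; field.
rewrite expRD.
by move: (expR e1) (expR e2) => x1 x2; ring.
Qed.

End rank1_constant.

(** * The mean of the precision matrix *)

Section mean.
Context {R : realType} {p : nat}.
Variable E : {set 'I_p * 'I_p}.
Hypothesis hE : parent_dag E.
Variables (U : 'M[R]_p) (pU : posdefmx U) (alpha : 'I_p -> R).
Context d (T : measurableType d) (P : probability T R).
Variables (D L : T -> 'M[R]_p) (hDL : DAG_Wishart E U alpha P D L).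

Let Om t := precision (D t) (L t).
Let th t : Theta E (D t, L t) := hDL.1 t.

Lemma measurable_theta_coord :
  measurable_fun setT (fun t => theta_coord E (D t) (L t)).
Proof. by have [_ [+ _ _ _ _]] := hDL. Qed.

Lemma measurable_precision i j :
  measurable_fun setT (fun t => Om t i j : measurableTypeR R).
Proof.
rewrite (_ : (fun t => _) = (fun x : @RE R p E => chart_precision x i j) \o
   (fun t => theta_coord E (D t) (L t))).
  exact: (measurableT_comp (measurable_chart_precision i j) measurable_theta_coord).
by apply/funext => t /=; rewrite (chart_precision_law hE hDL).
Qed.

Section quadratic_form.
Variable v : 'cV[R]_p.

Definition half_quad t : R := (v^T *m Om t *m v) 0 0 / 2.

(** Minus the derivative at 0 of the exponent in the Laplace transform. *)
Let limit : R :=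
  \sum_j (a_of E alpha j * quad_fa E U v j - (a_of E alpha j - 1 / 2) * quad_pa E U v j).

Lemma half_quad_ge0 t : 0 <= half_quad t.
Proof.
rewrite /half_quad divr_ge0//.
have [->|v0] := eqVneq v 0; first by rewrite mulmx0 mxE.
by apply/ltW/(posdef_precision (th t)).2.
Qed.

Lemma measurable_half_quad : measurable_fun setT (half_quad : T -> measurableTypeR R).
Proof.
apply: measurable_funM => //.
under eq_fun do rewrite mxE.
apply: measurable_sum => i; apply: measurable_funM => //.
under eq_fun do rewrite mxE.
by apply: measurable_sum => j; apply: measurable_funM => //; exact: measurable_precision.
Qed.

Let x_ (n : nat) : R := \sum_j ((a_of E alpha j - 1 / 2) * ln (1 + n.+1%:R^-1 * quad_pa E U v j) -
                  a_of E alpha j * ln (1 + n.+1%:R^-1 * quad_fa E U v j)).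

(** The rank one [K] is taken with the factor [1 / (2 n)], so that [U + 2 *: K] is
    [U] plus [1 / n] times the rank one matrix. *)
Let laplace_half_quad n :
  (\int[P]_t (expR (- (n.+1%:R^-1 * half_quad t)))%:E = (expR (x_ n))%:E)%E.
Proof.
have s0 : 0 <= n.+1%:R^-1 :> R by rewrite invr_ge0.
pose K : 'M[R]_p := (n.+1%:R^-1 / 2) *: (v *m v^T).
have KE : U + 2 *: K = U + n.+1%:R^-1 *: (v *m v^T).
  by rewrite /K scalerA mulrCA mulfV ?mulr1// pnatr_eq0.
have := laplace_transform hE hDL (K := K).
rewrite KE (zD_rank1 hE pU _ _ s0) mulrAC mulfV ?(zD_neq0 hE hDL)// [1 * expR _]mul1r.
move=> /(_ (posdef_rank1 pU v s0)) <-; rewrite unlock; apply: eq_integral => t _.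
congr (expR (- _))%:E; rewrite /K -scalemxAl mxtraceZ /half_quad.
have trE : \tr (v *m v^T *m Om t) = (v^T *m Om t *m v) 0 0.
  by rewrite -mulmxA mxtrace_mulC /mxtrace big_ord1.
by rewrite trE mulrA mulrAC.
Qed.

(** Difference quotients of the Laplace transform, as expectations. *)
Let g_ (n : nat) t : R := n.+1%:R * (1 - expR (- (n.+1%:R^-1 * half_quad t))).

Let scaled_ge0 n t : 0 <= n.+1%:R^-1 * half_quad t.
Proof. by rewrite mulr_ge0 ?half_quad_ge0// invr_ge0. Qed.

Let exp_le1 n t : expR (- (n.+1%:R^-1 * half_quad t)) <= 1.
Proof. by rewrite -[leRHS]expR0 ler_expR oppr_le0. Qed.

Let g_ge0 n t : 0 <= g_ n t.
Proof. by rewrite mulr_ge0// subr_ge0. Qed.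

Let g_le n t : g_ n t <= half_quad t.
Proof.
have -> : half_quad t = n.+1%:R * (n.+1%:R^-1 * half_quad t).
  by rewrite mulrA mulfV ?mul1r// pnatr_eq0.
rewrite ler_pM2l ?ltr0n// lerBlDl -lerBlDr.
exact: expR_ge1Dx.
Qed.

Let measurable_exp n : measurable_fun setT
  (fun t => expR (- (n.+1%:R^-1 * half_quad t)) : measurableTypeR R).
Proof.
apply: measurableT_comp => //; apply: measurableT_comp => //.
by apply: measurable_funM => //; exact: measurable_half_quad.
Qed.

Let measurable_g n : measurable_fun setT (g_ n : T -> measurableTypeR R).
Proof. by apply: measurable_funM => //; apply: measurable_funB => //; exact: measurable_exp. Qed.

Let g_cvg t : (fun n => g_ n t) @ \oo --> half_quad t.
Proof.
have c : (fun n => n.+1%:R * - (n.+1%:R^-1 * half_quad t)) @ \oo --> - half_quad t.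
  have -> : (fun n => n.+1%:R * - (n.+1%:R^-1 * half_quad t)) = cst (- half_quad t).
    by apply/funext => n; rewrite mulrN mulVKf// pnatr_eq0.
  exact: cvg_cst.
rewrite -[half_quad t]opprK.
have -> : (fun n => g_ n t) =
    - (fun n => n.+1%:R * (expR (- (n.+1%:R^-1 * half_quad t)) - 1)).
  by apply/funext => n; rewrite /g_ -[1 - _]opprB mulrN.
exact: cvgN (cvg_expRB1 c).
Qed.

Let integral_g n : (\int[P]_t (g_ n t)%:E = (n.+1%:R * (1 - expR (x_ n)))%:E)%E.
Proof.
under eq_integral do rewrite EFinM.
rewrite ge0_integralZl//; last 2 first.
- by apply/measurable_EFinP; apply: measurable_funB => //; exact: measurable_exp.
- by move=> t _; rewrite lee_fin subr_ge0.
rewrite EFinM; congr (_ * _)%E.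
have E1 : (\int[P]_t (1 - expR (- (n.+1%:R^-1 * half_quad t)))%:E +
    (expR (x_ n))%:E = 1)%E.
  rewrite -laplace_half_quad -ge0_integralD//.
  - transitivity (\int[P]_t (cst 1%E t))%E.
      by apply: eq_integral => t _; rewrite -EFinD subrK.
    by rewrite integral_cst// mul1e [LHS](@probability_setT _ _ _ P).
  - by move=> t _; rewrite lee_fin subr_ge0.
  - by apply/measurable_EFinP; apply: measurable_funB => //; exact: measurable_exp.
  - by apply/measurable_EFinP; exact: measurable_exp.
by rewrite EFinB -[X in (X - _)%E]E1 addeK.
Qed.

Let integral_g_cvg : (fun n => \int[P]_t (g_ n t)%:E)%E @ \oo --> limit%:E.
Proof.
under eq_fun do rewrite integral_g.
apply: cvg_EFin; first exact: nearW.
rewrite -[X in X @ \oo --> _]/(fun n => n.+1%:R * (1 - expR (x_ n))).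
have c : (fun n => n.+1%:R * x_ n) @ \oo --> - limit.
  rewrite (_ : - limit = \sum_j ((a_of E alpha j - 1 / 2) * quad_pa E U v j -
      a_of E alpha j * quad_fa E U v j)); last first.
    by rewrite /limit -sumrN; apply: eq_bigr => j _; rewrite opprB.
  rewrite (_ : (fun n => _) = fun n => \sum_j ((a_of E alpha j - 1 / 2) *
      (n.+1%:R * ln (1 + n.+1%:R^-1 * quad_pa E U v j)) -
      a_of E alpha j * (n.+1%:R * ln (1 + n.+1%:R^-1 * quad_fa E U v j)))); last first.
    apply/funext => n; rewrite /x_ mulr_sumr; apply: eq_bigr => j _.
    by rewrite mulrBr; congr (_ - _); rewrite mulrCA.
  apply: cvg_big => [|j _]; first exact: add_continuous.
  apply: cvgB.
    by apply: cvgM (cvg_cst _) (cvg_ln1D _); exact: quad_pa_ge0.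
  by apply: cvgM (cvg_cst _) (cvg_ln1D _); exact: quad_fa_ge0.
rewrite -[limit]opprK.
have -> : (fun n => n.+1%:R * (1 - expR (x_ n))) =
    - (fun n => n.+1%:R * (expR (x_ n) - 1)).
  by apply/funext => n; rewrite -[1 - _]opprB mulrN.
exact: cvgN (cvg_expRB1 c).
Qed.

(** Fatou's lemma bounds the expectation by the limit of the difference quotients,
    which in turn are dominated by the random variable itself.  In particular the
    expectation is finite. *)
Lemma expectation_half_quad : (\int[P]_t (half_quad t)%:E = limit%:E)%E.
Proof.
apply/eqP; rewrite eq_le; apply/andP; split.
  have := fatou P measurableT (fun n => iffRL (measurable_EFinP _ _) (measurable_g n)).
  move=> /(_ (fun n t _ => g_ge0 n t)).
  rewrite (cvg_limn_einf_sup integral_g_cvg).1; apply: le_trans.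
  rewrite le_eqVlt; apply/orP; left; apply/eqP/eq_integral => t _.
  apply/esym/(cvg_limn_einf_sup _).1.
  by apply: cvg_EFin; [exact: nearW|exact: g_cvg].
rewrite -(cvg_lim _ integral_g_cvg)//; apply: lime_le.
  by apply/cvg_ex; exists limit%:E; exact: integral_g_cvg.
apply: nearW => n; apply: ge0_le_integral => //.
- by move=> t _; rewrite lee_fin.
- by apply/measurable_EFinP; exact: measurable_g.
- by apply/measurable_EFinP; exact: measurable_half_quad.
- by move=> t _; rewrite lee_fin.
Qed.

End quadratic_form.

Let bilinear_delta (M : 'M[R]_p) i j :
  ((delta_mx i 0 : 'cV[R]_p)^T *m M *m (delta_mx j 0 : 'cV[R]_p)) 0 0 = M i j.
Proof. by rewrite trmx_delta -rowE -colE !mxE. Qed.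

Let polarisation (M : 'M[R]_p) i j : M^T = M ->
  let q (v : 'cV[R]_p) := (v^T *m M *m v) 0 0 / 2 in
  M i j = q (delta_mx i 0 + delta_mx j 0) - q (delta_mx i 0) - q (delta_mx j 0).
Proof.
move=> Ms q; rewrite /q [(_ + _)^T]linearD/= !mulmxDl !mulmxDr.
have addE (a b : 'M[R]_1) : (a + b) 0 0 = a 0 0 + b 0 0 by rewrite mxE.
rewrite !addE !bilinear_delta.
have -> : M j i = M i j by rewrite -[in LHS]Ms mxE.
by field.
Qed.

Lemma entry_half_quad i j t : Om t i j =
  half_quad (delta_mx i 0 + delta_mx j 0) t -
  half_quad (delta_mx i 0) t - half_quad (delta_mx j 0) t.
Proof.
exact: polarisation (posdef_precision (th t)).1.
Qed.

Lemma integrable_half_quad v : P.-integrable setT (fun t => (half_quad v t)%:E).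
Proof.
apply/integrableP; split.
  by apply/measurable_EFinP; exact: measurable_half_quad.
under eq_integral do rewrite gee0_abs ?lee_fin ?half_quad_ge0//.
by rewrite expectation_half_quad ltry.
Qed.

Lemma integrable_precision i j : P.-integrable setT (fun t => (Om t i j)%:E).
Proof.
apply: (eq_integrable measurableT (fun t => (half_quad (delta_mx i 0 + delta_mx j 0) t)%:E -
  (half_quad (delta_mx i 0) t)%:E - (half_quad (delta_mx j 0) t)%:E)%E).
  by move=> t _; rewrite -!EFinB -entry_half_quad.
apply: integrableB => //; last exact: integrable_half_quad.
by apply: integrableB => //; exact: integrable_half_quad.
Qed.

(** With [2 * a_of j] equal to [alpha j - #|pa j| - 2], the coefficients of the two
    families of padded inverses are those of the derivative. *)
Lemma mean_precision_quad (v : 'cV[R]_p) :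
  (v^T *m mean_precision E U alpha *m v) 0 0 / 2 =
  \sum_j (a_of E alpha j * quad_fa E U v j -
          (a_of E alpha j - 1 / 2) * quad_pa E U v j).
Proof.
rewrite /mean_precision mulmxBr mulmxBl !mulmx_sumr !mulmx_suml mxE [X in _ + X]mxE.
rewrite !summxE -sumrB mulr_suml; apply: eq_bigr => j _.
rewrite -!scalemxAr -!scalemxAl [X in X - _]mxE [X in _ - X]mxE.
rewrite -/(padinv U (fa E j)) -/(padinv U (pa E j)) -/(quad_fa E U v j) -/(quad_pa E U v j).
by rewrite /a_of; field.
Qed.

Lemma tr_mean_precision : (mean_precision E U alpha)^T = mean_precision E U alpha.
Proof.
rewrite /mean_precision [LHS]linearB/= [X in X - _]linear_sum [X in _ - X]linear_sum/=.
by congr (_ - _); apply: eq_bigr => j _; rewrite linearZ/= -/(padinv _ _) tr_padinv//; case: pU.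
Qed.

Lemma expectation_precision : expect_mx P Om = mean_precision E U alpha.
Proof.
apply/matrixP => i j; rewrite mxE unlock.
have iq v := integrable_half_quad v.
have -> : (\int[P]_t (Om t i j)%:E =
    \int[P]_t ((half_quad (delta_mx i 0 + delta_mx j 0) t)%:E -
      (half_quad (delta_mx i 0) t)%:E - (half_quad (delta_mx j 0) t)%:E))%E.
  by apply: eq_integral => t _; rewrite -!EFinB -entry_half_quad.
rewrite integralB//; last by apply: integrableB.
rewrite integralB// !expectation_half_quad -!EFinB /= -!mean_precision_quad.
by rewrite -polarisation// tr_mean_precision.
Qed.

End mean.

(** * The incomplete precision matrix *)

Section incomplete_matrices.
Context {R : realType} {p : nat}.
Variable E : {set 'I_p * 'I_p}.
Hypothesis hE : parent_dag E.
Implicit Types (x y z : @RE R p E).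

(** Equal to the diagonal coordinate on the chart and to 1 elsewhere, so that
    scaling by it is a bijection everywhere. *)
Definition scale_at j y : R := if 0 < entry y (j, j) then entry y (j, j) else 1.

(** The involution [(D, L) <-> (1 / D, L / D)] of the chart, column by column. *)
Definition invert_coord (e : 'I_p * 'I_p) y : R :=
  if e.1 == e.2 then (entry y e)^-1 else (scale_at e.2 y)^-1 * entry y e.

(** Its Jacobian, which vanishes off the chart. *)
Definition invert_weight (e : 'I_p * 'I_p) y : R :=
  if e.1 == e.2 then (0 < entry y e)%R%:R * entry y e ^- 2
  else (scale_at e.2 y)^-1.

Definition invert_chart y : @RE R p E := [tuple invert_coord (enum_val k) y | k < #|E|].

(** The part of the entry [e] of the precision matrix due to columns before
    [e.2], in inverted coordinates. *)
Definition shear_coord (e : 'I_p * 'I_p) y : R :=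
  \sum_(k : 'I_p | (k < e.2)%N) entry y (e.1, k) * entry y (e.2, k) / entry y (k, k).

Definition schur_shear y : @RE R p E :=
  [tuple tnth y k + shear_coord (enum_val k) y | k < #|E|].

Lemma scale_at_gt0 j y : 0 < scale_at j y.
Proof. by rewrite /scale_at; case: ifP. Qed.

Lemma scale_at_chart j y : in_chart y -> scale_at j y = entry y (j, j).
Proof. by move=> /forallP/(_ j) yj; rewrite /scale_at yj. Qed.

Lemma entry_invert y i j : (i, j) \in E -> entry (invert_chart y) (i, j) = invert_coord (i, j) y.
Proof. by move=> ijE; rewrite (entry_tupleE (g := fun e => invert_coord e y)). Qed.

Lemma invert_in_chart y : in_chart y -> in_chart (invert_chart y).
Proof.
move=> /forallP yc; apply/forallP => j.
by rewrite entry_invert ?hE.1// /invert_coord/= eqxx invr_gt0.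
Qed.

Lemma entry_invert_off y i j : in_chart y -> i != j ->
  entry (invert_chart y) (i, j) = entry y (i, j) / entry y (j, j).
Proof.
move=> yc ij; have [ijE|ijE] := boolP ((i, j) \in E); last first.
  by rewrite !(entry_out _ ijE) mul0r.
by rewrite entry_invert// /invert_coord/= (negbTE ij) scale_at_chart// mulrC.
Qed.

Lemma entry_invert_diag y j : entry (invert_chart y) (j, j) = (entry y (j, j))^-1.
Proof. by rewrite entry_invert ?hE.1// /invert_coord/= eqxx. Qed.

Lemma invert_chartK y : in_chart y -> invert_chart (invert_chart y) = y.
Proof.
move=> yc; apply: eq_from_tnth => k; rewrite -!entry_tnth.
have := enum_valP k; case: (enum_val k) => i j ijE.
case: (eqVneq i j) => [->|ij]; first by rewrite !entry_invert_diag invrK.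
rewrite entry_invert_off//; last exact: invert_in_chart.
rewrite entry_invert_off// entry_invert_diag invrK divfK// gt_eqF//.
exact: (forallP yc).
Qed.

Lemma measurable_scale_at j :
  measurable_fun setT (fun y => scale_at j y : measurableTypeR R).
Proof.
apply: measurable_fun_ifT => //; last exact: measurable_entry.
exact: measurable_fun_ltr (measurable_cst _) (measurable_entry _).
Qed.

Lemma measurable_invert_coord e :
  measurable_fun setT (fun y => invert_coord e y : measurableTypeR R).
Proof.
rewrite /invert_coord; case: eqP => _.
  exact: (measurableT_comp measurable_invr (measurable_entry _)).
apply: measurable_funM; last exact: measurable_entry.
exact: (measurableT_comp measurable_invr (measurable_scale_at _)).
Qed.

Lemma measurable_invert_weight e :
  measurable_fun setT (fun y => invert_weight e y : measurableTypeR R).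
Proof.
rewrite /invert_weight; case: eqP => _.
  apply: measurable_funM; first exact: (measurable_gt0 (measurable_entry e)).
  apply: (measurableT_comp measurable_invr).
  by apply: measurable_funX; exact: measurable_entry.
exact: (measurableT_comp measurable_invr (measurable_scale_at _)).
Qed.

Lemma measurable_invert_chart : measurable_fun setT invert_chart.
Proof.
apply: measurable_to_Rn => k; under eq_fun do rewrite tnth_mktuple.
exact: measurable_invert_coord.
Qed.

Lemma invert_weight_ge0 e y : 0 <= invert_weight e y.
Proof.
rewrite /invert_weight; case: eqP => _; last by rewrite invr_ge0 ltW// scale_at_gt0.
by rewrite mulr_ge0// invr_ge0 exprn_even_ge0.
Qed.

Lemma measurable_shear_coord e :
  measurable_fun setT (fun y => shear_coord e y : measurableTypeR R).
Proof.
rewrite /shear_coord; under eq_fun do rewrite big_mkcond.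
apply: measurable_sum => k; case: (k < e.2)%N => //.
apply: measurable_funM; first by apply: measurable_funM; exact: measurable_entry.
exact: (measurableT_comp measurable_invr (measurable_entry _)).
Qed.

(** In inverted coordinates the term of column [k] in the entry [(i, j)] of the
    precision matrix is [y_ik y_jk / y_kk]; for [k = j] this is the coordinate
    [y_ij] itself, and for [k > j] it vanishes since [L] is triangular. *)
Lemma psi_invert_chart y : in_chart y ->
  psi E (coordD (invert_chart y)) (coordL (invert_chart y)) = schur_shear y.
Proof.
move=> yc; have xc := invert_in_chart yc; have th := elimT (in_chartP hE _) xc.
apply: eq_from_tnth => k; rewrite !tnth_mktuple -entry_tnth /shear_coord.
have := enum_valP k; case: (enum_val k) => i j /= ijE.
rewrite (precisionE th) (bigD1 j)//=; congr (_ + _).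
  rewrite !mxE !eqxx mulr1n mulr1 entry_invert_diag invrK.
  have yj : entry y (j, j) != 0 by rewrite gt_eqF// (forallP yc).
  case: eqVneq => [->|ij]; first by rewrite mul1r.
  by rewrite entry_invert_off// divfK.
have ji : (j <= i)%N.
  by case: (eqVneq i j) => [->//|ij]; rewrite ltnW// (hE.2 _ _ ijE).
rewrite big_mkcond [RHS]big_mkcond; apply: eq_bigr => l _.
case: eqVneq => [->|lj]/=; first by rewrite ltnn.
have [lj'|jl] := ltnP l j; last first.
  have [_ _ [/is_trig_mxP tL _ _]] := th.
  by rewrite [coordL _ j l]tL ?mulr0 ?mul0r// ltn_neqAle eq_sym lj.
have li : i != l by rewrite neq_ltn (leq_trans lj' ji) orbT.
have jl : j != l by rewrite eq_sym.
rewrite ![coordL _ _ _]mxE (negbTE li) (negbTE jl) !entry_invert_off//.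
rewrite [coordD _ _ _]mxE eqxx mulr1n entry_invert_diag.
have yl : entry y (l, l) != 0 by rewrite gt_eqF// (forallP yc).
by field.
Qed.

Lemma shear_rank (k : 'I_#|E|) :
  depends_below (fun k : 'I_#|E| => nat_of_ord (enum_val k).2) k
    (shear_coord (enum_val k)).
Proof.
move=> x y xy; apply: eq_bigr => l lk.
by congr (_ * _ / _); apply: eq_entry => m mE; apply: xy; rewrite mE.
Qed.

Lemma schur_shear_inverse : exists g : @RE R p E -> @RE R p E,
  [/\ measurable_fun setT g, cancel schur_shear g & cancel g schur_shear].
Proof.
exact: (shear_measurable_inverse shear_rank
  (fun k => measurable_shear_coord (enum_val k))).
Qed.

Lemma schur_shear_inj : injective schur_shear.
Proof. by have [g [_ gK _]] := schur_shear_inverse; exact: can_inj gK. Qed.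

Lemma psi_shear (D L : 'M[R]_p) : Theta E (D, L) ->
  psi E D L = schur_shear (invert_chart (theta_coord E D L)).
Proof.
move=> th; have [DE LE] := theta_coordK hE th.
have xc : in_chart (theta_coord E D L) by apply/(in_chartP hE); rewrite DE LE.
by rewrite -psi_invert_chart ?invert_in_chart// invert_chartK// DE LE.
Qed.

Lemma psi_inj (D L D' L' : 'M[R]_p) : Theta E (D, L) -> Theta E (D', L') ->
  psi E D L = psi E D' L' -> D = D' /\ L = L'.
Proof.
move=> th th'; have [DE LE] := theta_coordK hE th.
have [DE' LE'] := theta_coordK hE th'.
rewrite !psi_shear// => /schur_shear_inj/(congr1 invert_chart).
rewrite !invert_chartK.
- move=> xx; split.
    exact: (etrans (esym DE) (etrans (congr1 (@coordD _ _ _) xx) DE')).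
  exact: (etrans (esym LE) (etrans (congr1 (@coordL _ _ _) xx) LE')).
- by apply/(in_chartP hE); rewrite DE' LE'.
- by apply/(in_chartP hE); rewrite DE LE.
Qed.

(** The choice in [completion] is forced, because the incomplete matrix determines
    [D] and [L] by injectivity of the shear. *)
Lemma completion_psi (D L : 'M[R]_p) : Theta E (D, L) ->
  completion E (psi E D L) = precision D L.
Proof.
move=> th; rewrite /completion; case: xgetP => [Om _ [[[D' L'] /= th' ->]]|h].
  by move=> /(psi_inj th' th)[-> ->].
by have := h (precision D L) (conj (ex_intro2 _ _ (D, L) th erefl) erefl).
Qed.

Lemma RD_shear y : RD E (schur_shear y) <-> in_chart y.
Proof.
split=> [[_ [[D L] /= th ->]]|yc].
  rewrite -/(psi E D L) psi_shear// => /schur_shear_inj <-.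
  apply: invert_in_chart; apply/(in_chartP hE).
  by have [-> ->] := theta_coordK hE th.
have th := elimT (in_chartP hE _) (invert_in_chart yc).
exists (precision (coordD (invert_chart y)) (coordL (invert_chart y))); last exact: psi_invert_chart.
by exists (coordD (invert_chart y), coordL (invert_chart y)).
Qed.

Lemma integral_invert_chart (G : @RE R p E -> R) : measurable_fun setT G -> (forall x, 0 <= G x) ->
  (\int[lebesgue_Rn R #|E|]_y
      (G (invert_chart y) * \prod_(k < #|E|) invert_weight (enum_val k) y)%:E =
   \int[lebesgue_Rn R #|E|]_x (G x * (in_chart x)%:R)%:E)%E.
Proof.
move=> mG G0.
pose rk (k : 'I_#|E|) : nat := (enum_val k).1 != (enum_val k).2.
pose sigma (k : 'I_#|E|) (t : measurableTypeR R) : R :=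
  if (enum_val k).1 == (enum_val k).2 then (0 < t)%R%:R else 1.
have dep_scale (k : 'I_#|E|) x y : (enum_val k).1 != (enum_val k).2 ->
    (forall i, (i == k) || (rk i < rk k)%N -> tnth x i = tnth y i) ->
    scale_at (enum_val k).2 x = scale_at (enum_val k).2 y.
  move=> ne xy; rewrite /scale_at.
  suff -> : entry x ((enum_val k).2, (enum_val k).2) =
            entry y ((enum_val k).2, (enum_val k).2) by [].
  by apply: eq_entry => m mE; apply: xy; rewrite /rk mE/= eqxx ne orbT.
have dep_u (k : 'I_#|E|) : depends_upto rk k (invert_coord (enum_val k)).
  move=> x y xy; rewrite /invert_coord !entry_tnth xy ?eqxx//.
  by case: eqVneq => // ne; rewrite (dep_scale _ _ _ ne xy).
have dep_rho (k : 'I_#|E|) : depends_upto rk k (invert_weight (enum_val k)).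
  move=> x y xy; rewrite /invert_weight !entry_tnth xy ?eqxx//.
  by case: eqVneq => // ne; rewrite (dep_scale _ _ _ ne xy).
have msigma k : measurable_fun setT (sigma k).
  rewrite /sigma; case: eqP => _ //; exact: (measurable_gt0 (f := id)).
have sigma0 k t : 0 <= sigma k t by rewrite /sigma; case: eqP.
have slice (k : 'I_#|E|) x (f : measurableTypeR R -> R) : measurable_fun setT f ->
    (forall t, 0 <= f t) ->
    (\int[lebesgue_measure]_t (f (invert_coord (enum_val k) (upd x k t)) *
        invert_weight (enum_val k) (upd x k t))%:E =
     \int[lebesgue_measure]_t (f t * sigma k t)%:E)%E.
  move=> mf f0; rewrite /invert_coord /invert_weight /sigma; case: eqVneq => ne.
    rewrite -ge0_integral_inversion//; apply: eq_integral => t _.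
    by rewrite entry_upd eqxx.
  have scE t : scale_at (enum_val k).2 (upd x k t) = scale_at (enum_val k).2 x.
    rewrite /scale_at entry_upd (_ : (_ == _) = false)//.
    by apply/eqP => kk; move: ne; rewrite -kk eqxx.
  under eq_integral do rewrite entry_upd eqxx scE -[_^-1 * _]addr0.
  rewrite ge0_integral_affine//; last by rewrite invr_gt0 scale_at_gt0.
  by apply: eq_integral => t _; rewrite mulr1.
rewrite (triangular_change_of_variables dep_u dep_rho
  (fun k => measurable_invert_coord (enum_val k))
  (fun k => measurable_invert_weight (enum_val k)) msigma
  (fun k => invert_weight_ge0 (enum_val k)) sigma0 slice mG G0).
apply: eq_integral => x _; congr (_ * _)%:E.
pose s (e : 'I_p * 'I_p) : R := if e.1 == e.2 then (0 < entry x e)%R%:R else 1.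
have -> : \prod_k sigma k (tnth x k) = \prod_(k < #|E|) s (enum_val k).
  by apply: eq_bigr => k _; rewrite /sigma /s entry_tnth.
rewrite (prod_dag hE) /s /=; case: (boolP (in_chart x)) => [/forallP xc|].
  rewrite big1// => j _; rewrite eqxx xc mul1r big1// => i ip.
  by rewrite ifF//; apply/eqP => ij; have := pa_self hE j; rewrite -{1}ij ip.
rewrite negb_forall => /existsP[j /negbTE xj].
by rewrite (bigD1 j)//= eqxx xj !mul0r.
Qed.

Lemma integral_shear (F : @RE R p E -> R) : measurable_fun setT F -> (forall x, 0 <= F x) ->
  (\int[lebesgue_Rn R #|E|]_y (F (schur_shear y))%:E =
   \int[lebesgue_Rn R #|E|]_z (F z)%:E)%E.
Proof.
move=> mF F0.
pose u (k : 'I_#|E|) y : R := tnth y k + shear_coord (enum_val k) y.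
have bupd (k : 'I_#|E|) x t : shear_coord (enum_val k) (upd x k t) = shear_coord (enum_val k) x.
  apply: shear_rank => i ik; rewrite tnth_upd; case: eqP => // ikE.
  by move: ik; rewrite ikE ltnn.
have dep_u (k : 'I_#|E|) :
    depends_upto (fun k : 'I_#|E| => nat_of_ord (enum_val k).2) k (u k).
  by move=> x y xy; rewrite /u (depends_belowW (shear_rank (k := k)) xy) xy// eqxx.
have mu k : measurable_fun setT (u k : _ -> measurableTypeR R).
  apply: measurable_funD; first exact: measurable_coord.
  exact: measurable_shear_coord.
have slice (k : 'I_#|E|) x (f : measurableTypeR R -> R) : measurable_fun setT f ->
    (forall t, 0 <= f t) ->
    (\int[lebesgue_measure]_t (f (u k (upd x k t)) * 1)%:E =
     \int[lebesgue_measure]_t (f t * 1)%:E)%E.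
  move=> mf f0; under [RHS]eq_integral do rewrite mulr1.
  rewrite -[RHS](ge0_integral_affine (shear_coord (enum_val k) x) ltr01)//.
  by apply: eq_integral => t _; rewrite /u bupd tnth_upd eqxx mul1r !mulr1.
have := triangular_change_of_variables dep_u
  (rho := fun _ _ => 1) (sigma := fun _ _ => 1) (fun _ _ _ _ => erefl) mu
  (fun _ => measurable_cst _) (fun _ => measurable_cst _)
  (fun _ _ => ler01) (fun _ _ => ler01) slice mF F0.
under eq_integral do rewrite big1 ?mulr1//.
by under [X in _ = X -> _]eq_integral do rewrite big1 ?mulr1//.
Qed.

Section density.
Variables (U : 'M[R]_p) (alpha : 'I_p -> R).

(** The density of the law in inverted coordinates. *)
Definition pulled_density y : R :=
  (zD E U alpha)^-1 * theta_kernel U alpha (invert_chart y) *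
  \prod_(k < #|E|) invert_weight (enum_val k) y.

Lemma measurable_pulled_density : measurable_fun setT pulled_density.
Proof.
apply: measurable_funM.
  apply: measurable_funM => //.
  exact: (measurableT_comp (measurable_theta_kernel U alpha) measurable_invert_chart).
by apply: measurable_prod => k _; exact: measurable_invert_weight.
Qed.

Lemma prod_invert_weight y : in_chart y -> \prod_(k < #|E|) invert_weight (enum_val k) y =
  \prod_j (entry y (j, j))^-1 ^+ (#|pa E j| + 2).
Proof.
move=> yc; rewrite (prod_dag hE (fun e => invert_weight e y)); apply: eq_bigr => j _.
rewrite {1}/invert_weight/= eqxx (forallP yc) mul1r addnC exprD -exprVn; congr (_ * _).
rewrite -prodr_const; apply: eq_bigr => i ip; rewrite /invert_weight/= ifF.
  by rewrite scale_at_chart.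
by apply/eqP => ij; have := pa_self hE j; rewrite -{1}ij ip.
Qed.

(** The Jacobian of the inversion raises the exponent of [D j j] from
    [- alpha j / 2] to [- alpha j / 2 + #|pa j| + 2]; off the chart both sides
    vanish. *)
Lemma RD_density_shear y :
  (RD_density E U alpha \_ (RD E)) (schur_shear y) = pulled_density y.
Proof.
rewrite patchE; case: ifPn => [/set_mem/RD_shear yc|]; last first.
  rewrite notin_setE => yc.
  have {}yc : ~~ in_chart y by apply/negP => /RD_shear.
  rewrite /pulled_density (prod_dag hE (fun e => invert_weight e y)).
  move: yc; rewrite negb_forall => /existsP[j /negbTE yj].
  by rewrite (bigD1 j)//= {1}/invert_weight/= eqxx yj !mul0r mulr0.
have xc := invert_in_chart yc; have th := elimT (in_chartP hE _) xc.
rewrite /RD_density -psi_invert_chart// completion_psi//.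
rewrite /pulled_density prod_invert_weight// /theta_kernel xc [true%:R * _]mul1r.
rewrite (chart_precisionE hE xc) -!mulrA; congr (_ * (_ * _)).
rewrite -big_split/=; apply: eq_bigr => j _.
rewrite (condvar_inv_precision hE th) [coordD _ _ _]mxE eqxx mulr1n.
rewrite entry_invert_diag.
have yj : 0 < (entry y (j, j))^-1 by rewrite invr_gt0 (forallP yc).
rewrite -powR_mulrn ?ltW// -powRD; last by rewrite (gt_eqF yj) implybT.
by congr (_ `^ _); rewrite natrD; field.
Qed.

(** [RD] is the preimage of the chart under the measurable inverse of the
    shear. *)
Lemma measurable_RD : measurable (RD E : set (@RE R p E)).
Proof.
have [g [mg gK Kg]] := schur_shear_inverse.
have -> : RD E = (fun z => (in_chart (g z))%:R : measurableTypeR R) @^-1` [set 1].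
  apply/funext => z; apply/propext; split.
    by rewrite -{1}(Kg z) => /RD_shear zc; rewrite /preimage/= zc.
  rewrite -{2}(Kg z) /preimage/= => h; apply/RD_shear; move: h.
  by case: in_chart => //= /eqP; rewrite eq_sym oner_eq0.
rewrite -[X in measurable X]setTI.
by apply: (measurableT_comp (measurable_in_chart (E := E)) mg).
Qed.

Lemma measurable_RD_density :
  measurable_fun setT (RD_density E U alpha \_ (RD E) : @RE R p E -> measurableTypeR R).
Proof.
have [g [mg gK Kg]] := schur_shear_inverse.
rewrite (_ : _ \_ _ = pulled_density \o g).
  exact: measurableT_comp measurable_pulled_density mg.
by apply/funext => z /=; rewrite -RD_density_shear Kg.
Qed.

End density.

End incomplete_matrices.

(** * The law of the incomplete precision matrix *)

Section incomplete_law.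
Context {R : realType} {p : nat}.
Variable E : {set 'I_p * 'I_p}.
Hypothesis hE : parent_dag E.
Variables (U : 'M[R]_p) (alpha : 'I_p -> R).
Context d (T : measurableType d) (P : probability T R).
Variables (D L : T -> 'M[R]_p) (hDL : DAG_Wishart E U alpha P D L).

Lemma measurable_psi : measurable_fun setT (fun t => psi E (D t) (L t)).
Proof.
apply: measurable_to_Rn => k; under eq_fun do rewrite tnth_mktuple.
exact: (measurable_precision hE hDL).
Qed.

(** The law is carried from the chart to inverted coordinates, then through the
    shear, which preserves the Lebesgue measure. *)
Lemma psi_has_density :
  has_density P (fun t => psi E (D t) (L t)) (RD E) (RD_density E U alpha).
Proof.
have z0 := zD_ge0 E U alpha.
have D0 z : 0 <= RD_density E U alpha z.
  rewrite !mulr_ge0 ?invr_ge0 ?expR_ge0// prodr_ge0// => j _.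
  exact: powR_ge0.
have mR := measurable_RD_density hE U alpha.
split => //; [exact: measurable_psi|exact: measurable_RD| |].
  exact/(measurable_restrictT _ (measurable_RD hE)).
move=> B mB.
have mB1 : measurable_fun setT (\1_B : @RE R p E -> measurableTypeR R).
  exact: measurable_indic.
pose pr (x : @RE R p E) : @RE R p E := projRE E (chart_precision x).
have mpr : measurable_fun setT pr.
  apply: measurable_to_Rn => k; under eq_fun do rewrite tnth_mktuple.
  exact: measurable_chart_precision.
pose G (x : @RE R p E) : R :=
  \1_B (pr x) * ((zD E U alpha)^-1 * theta_kernel U alpha x).
have mG : measurable_fun setT G.
  apply: measurable_funM; first exact: (measurableT_comp mB1 mpr).
  by apply: measurable_funM => //; exact: measurable_theta_kernel.
have G0 x : 0 <= G x.
  apply: mulr_ge0 => //; apply: mulr_ge0; last exact: theta_kernel_ge0.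
  by rewrite invr_ge0.
pose F (z : @RE R p E) : R := \1_B z * (RD_density E U alpha \_ (RD E)) z.
have mF : measurable_fun setT F by exact: measurable_funM.
have F0 z : 0 <= F z.
  by rewrite mulr_ge0// patchE; case: ifP.
transitivity (\int[P]_t (\1_B (pr (theta_coord E (D t) (L t))))%:E)%E.
  rewrite -(setIT (_ @^-1` B)) -integral_indic//; last first.
    by rewrite -[X in measurable X]setTI; exact: measurable_psi.
  by apply: eq_integral => t _; rewrite /pr (chart_precision_law hE hDL).
have mgB : measurable_fun setT (fun x => \1_B (pr x) : R).
  exact: (measurableT_comp mB1 mpr).
rewrite (expectation_chart hE hDL mgB)//.
transitivity (\int[lebesgue_Rn R #|E|]_x (G x * (in_chart x)%:R)%:E)%E.
  apply: eq_integral => x _; congr EFin; rewrite /G /theta_kernel.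
  by case: (in_chart x); rewrite ?mulr1// !mul0r !mulr0.
rewrite -(integral_invert_chart hE mG G0).
transitivity (\int[lebesgue_Rn R #|E|]_y (F (schur_shear y))%:E)%E.
  apply: eq_integral => y _; congr EFin; rewrite /F (RD_density_shear hE) /G.
  rewrite -mulrA -/(pulled_density U alpha y).
  have [yc|yc] := boolP (in_chart y).
    by rewrite /pr (chart_precisionE hE (invert_in_chart hE yc)) -(psi_invert_chart hE yc).
  rewrite -(RD_density_shear hE) patchE ifF ?mulr0//.
  by apply/negP => /set_mem/(RD_shear hE) h; rewrite h in yc.
rewrite (integral_shear mF F0) setIC integral_mkcondr integral_mkcond.
apply: eq_integral => z _; rewrite /F !patchE indicE.
case: (z \in RD E); case: (z \in B) => /=; rewrite ?mul1r ?mul0r ?mulr0//.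
Qed.

End incomplete_law.

Theorem theorem4p6 (R : realType) (p : nat) (E : {set 'I_p * 'I_p})
  (hE : parent_dag E)
  (U : 'M[R]_p) (hU : posdefmx U)
  (alpha : 'I_p -> R) (halpha : forall i, #|pa E i|%:R + 2 < alpha i)
  (d : measure_display) (T : measurableType d) (P : probability T R)
  (D L : T -> 'M[R]_p) (hDL : DAG_Wishart E U alpha P D L) :
  let Omega := fun t => precision (D t) (L t) in
  let Upsilon := fun t => psi E (D t) (L t) in
  [/\ [/\ has_density P Upsilon (RD E) (RD_density E U alpha) &
          forall t i,
            D t i i = condvar (invmx (completion E (Upsilon t))) i (pa E i)],
      forall K : 'M[R]_p, K^T = K -> posdefmx (U + 2 *: K) ->
        ('E_P[fun t => expR (- \tr (K *m Omega t))]
          = (zD E (U + 2 *: K) alpha / zD E U alpha)%:E)%E,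
      forall H : RE E, posdefmx (U + 2 *: KH H) ->
        ('E_P[fun t => expR (- pairing H (Upsilon t))]
          = (zD E (U + 2 *: KH H) alpha / zD E U alpha)%:E)%E,
      (forall i j, P.-integrable setT (fun t => (Omega t i j)%:E)) /\
      expect_mx P Omega = mean_precision E U alpha &
      (forall k, P.-integrable setT (fun t => (tnth (Upsilon t) k)%:E)) /\
      expect_Rn P Upsilon = projRE E (expect_mx P Omega)].
Proof.
move=> Omega Upsilon.
have th t : Theta E (D t, L t) := hDL.1 t.
have laplace := laplace_transform hE hDL.
split.
- split; first exact: (psi_has_density hE hDL).
  move=> t i; rewrite /Upsilon completion_psi//.
  by rewrite (condvar_inv_precision hE (th t)).
- by move=> K _; exact: laplace.
- move=> H pH; rewrite -laplace// unlock; apply: eq_integral => t _.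
  by rewrite /Upsilon (pairing_trace hE H (th t)).
- by split; [exact: (integrable_precision hE hU hDL)|exact: (expectation_precision hE hU hDL)].
- split=> [k|].
    under eq_fun do rewrite tnth_mktuple.
    exact: (integrable_precision hE hU hDL).
  apply: eq_from_tnth => k; rewrite !tnth_mktuple mxE unlock.
  by congr fine; apply: eq_integral => t _; rewrite tnth_mktuple.
Qed.
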